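(* There is an algorithm that, given $m \in \mathbb{N}$ with $m \geq 3$, Boolean variables $t_0, \dotsc, t_{m-1}$ and arrival times $a : \{t_0, \dotsc, t_{m-1}\} \to \mathbb{N}$, computes in time $\mathcal{O}(m^2 \log_2 m)$ a Boolean circuit over $\{\land,\lor\}$ realizing the \textsc{And}-\textsc{Or} path $t_0 \land (t_1 \lor (t_2 \land ( \dotsb t_{m-1}) \dotsb ))$ with delay at most $\log_2 W + \log_2 \log_2 m + \log_2 \log_2 \log_2 m + 4.3$ (where $W := \sum_{i=0}^{m-1} 2^{a(t_i)}$), and this circuit has size at most $10\, m \log_2 m \log_2 \log_2 m$ and maximum fanout at most $\log_2 m + \log_2 \log_2 m + \log_2 \log_2 \log_2 m + 3.3$.
   Context: The \textsc{And}-\textsc{Or} path $t_0 \land (t_1 \lor (t_2 \land ( \dotsb t_{m-1}) \dotsb ))$ is the function $g(t)$ defined recursively by $g(t) = g^*(t) = t_0$ for $m = 1$ and, for $m>1$, $g(t) = t_0 \land g^*((t_1,\dotsc,t_{m-1}))$, $g^*(t) = t_0 \lor g((t_1,\dotsc,t_{m-1}))$. A Boolean circuit over $\{\land,\lor\}$ is a directed acyclic graph whose indegree-0 nodes (inputs) are labeled by Boolean variables, with a unique outdegree-0 node (output) of indegree 1, and all other nodes are gates of indegree exactly 2 labeled \textsc{And} or \textsc{Or}; it realizes a Boolean function if its output computes that function for all input values. The delay of an input $x$ is $a(x)$ plus the maximum number of gates on any directed path starting at $x$; the delay of the circuit is the maximum delay over its inputs. The size of a circuit is its number of gates; the maximum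 fanout is the maximum number of successors (out-neighbors) of any input or gate. *)

(* Defs.v *)
From mathcomp Require Import all_boot all_order all_algebra.
From mathcomp Require Import reals exp.

Set Implicit Arguments.
Unset Strict Implicit.
Unset Printing Implicit Defensive.

(* [and_or_path] is g and [or_and_path] is g^*; the value on the empty sequence
   is irrelevant, g and g^* being defined for m >= 1 only. *)
Fixpoint and_or_path (t : seq bool) : bool :=
  match t with
  | [::] => true
  | [:: t0] => t0
  | t0 :: t' => t0 && or_and_path t'
  end
with or_and_path (t : seq bool) : bool :=
  match t with
  | [::] => true
  | [:: t0] => t0
  | t0 :: t' => t0 || and_or_path t'
  end.

Inductive node_kind (m : nat) : Type :=
  Input of 'I_m | AndGate | OrGate | Output.

Arguments AndGate {m}.
Arguments OrGate {m}.
Arguments Output {m}.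

Record netlist (m : nat) := Netlist {
  node : finType;
  edge : rel node;
  kind : node -> node_kind m
}.

Section Circuits.

Variables (m : nat) (c : netlist m).
Implicit Types (u v w : node c) (a : 'I_m -> nat).

Definition is_gate u : bool :=
  match kind u with AndGate | OrGate => true | _ => false end.

Definition is_output u : bool :=
  match kind u with Output => true | _ => false end.

Definition indegree u : nat := #|[pred w | edge w u]|.
Definition outdegree u : nat := #|[pred w | edge u w]|.

(* Each variable labels at most one input node, so that the fanout of a
   variable is the fanout of its node. *)
Record is_circuit : Prop := IsCircuit {
  circuit_acyclic : forall u v, edge u v -> ~~ connect (@edge m c) v u;
  circuit_indegree : forall u,
    indegree u = match kind u with
                 | Input _ => 0
                 | AndGate | OrGate => 2
                 | Output => 1
                 end;
  circuit_outdegree : forall u, (outdegree u == 0) = is_output u;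
  circuit_output : exists! u, is_output u;
  circuit_input_inj : forall u v i, kind u = Input i -> kind v = Input i -> u = v
}.

(* [x] gives the values carried by the nodes when t is the input.  By acyclicity
   there is exactly one such [x]; see [valuation_ex] and [valuation_uniq]. *)
Definition valuation (t : m.-tuple bool) (x : node c -> bool) : Prop :=
  forall u, x u = match kind u with
                  | Input i => tnth t i
                  | AndGate => [forall w, edge w u ==> x w]
                  | OrGate | Output => [exists w, edge w u && x w]
                  end.

Definition realizes (f : m.-tuple bool -> bool) : Prop :=
  forall t, exists2 x, valuation t x & forall u, is_output u -> x u = f t.

Definition size_of : nat := #|[pred u | is_gate u]|.

Definition max_fanout : nat := \max_(u : node c | ~~ is_output u) outdegree u.

(* A path is [u] followed by a tuple [p]; in an acyclic graph it has at most #|node c| nodes. *)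
Definition max_gates u : nat :=
  \max_(k < #|node c|)
    \max_(p : k.-tuple (node c) | path (@edge m c) u p) count is_gate (u :: p).

Definition delay a : nat :=
  \max_(u : node c)
    match kind u with Input i => a i + max_gates u | _ => 0 end.

Section Valuations.

Hypothesis hc : is_circuit.
Variable t : m.-tuple bool.

Let anc u := #|[pred w | connect (@edge m c) w u]|.

Let anc_lt u w : edge w u -> anc w < anc u.
Proof.
move=> ewu; apply: proper_card; apply/properP; split.
  by apply/subsetP=> z; rewrite !inE => /connect_trans; apply; apply: connect1.
by exists u; rewrite !inE ?connect0 // (circuit_acyclic hc).
Qed.

Lemma valuation_uniq x y : valuation t x -> valuation t y -> x =1 y.
Proof.
move=> hx hy u; have [n] := ubnP (anc u); elim: n u => // n IH u /ltnSE le_n.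
have xy w : edge w u -> x w = y w.
  by move=> /anc_lt lt_w; apply: IH; apply: leq_trans lt_w le_n.
rewrite hx hy; case: (kind u) => // [||].
- by apply: eq_forallb => w; case: (boolP (edge w u)) => // /xy ->.
- by apply: eq_existsb => w; case: (boolP (edge w u)) => // /xy ->.
- by apply: eq_existsb => w; case: (boolP (edge w u)) => // /xy ->.
Qed.

Lemma valuation_ex : exists x, valuation t x.
Proof.
pose step (x : node c -> bool) u := match kind u with
  | Input i => tnth t i
  | AndGate => [forall w, edge w u ==> x w]
  | OrGate | Output => [exists w, edge w u && x w]
  end.
have stepP x y u : (forall w, edge w u -> x w = y w) -> step x u = step y u.
  rewrite /step => xy; case: (kind u) => // [||].
  - by apply: eq_forallb => w; case: (boolP (edge w u)) => // /xy ->.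
  - by apply: eq_existsb => w; case: (boolP (edge w u)) => // /xy ->.
  - by apply: eq_existsb => w; case: (boolP (edge w u)) => // /xy ->.
have anc_gt0 u : 0 < anc u.
  by apply/card_gt0P; exists u; rewrite inE connect0.
have stable n k u : anc u <= n -> anc u <= k ->
    iter n step xpred0 u = iter k step xpred0 u.
  elim: n k u => [|n IH] [|k] u //.
  - by rewrite leqNgt anc_gt0.
  - by move=> _; rewrite leqNgt anc_gt0.
  move=> le_n le_k; apply: stepP => w /anc_lt lt_w.
  by apply: IH; rewrite -ltnS; [apply: leq_trans lt_w le_n | apply: leq_trans lt_w le_k].
exists (iter #|node c| step xpred0) => u.
rewrite -/(step _ u) -iterS; apply: stable; first exact: max_card.
by apply: leqW; apply: max_card.
Qed.

End Valuations.

End Circuits.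

(* A program uses finitely many registers and arrays, all holding natural
   numbers.  The elementary operations are the classical ones of the uniform-cost
   additive RAM (reading, writing with indirect addressing, +, truncated -,
   comparisons, conditional branching); multiplication, division, shifts and
   logarithms are not elementary. *)
Inductive binop := Add | Sub | Leq | Eq.

Inductive expr :=
  | Lit of nat
  | Reg of nat
  | Read of nat & expr            (* Read b e : array b at index e *)
  | Op of binop & expr & expr.

Inductive cmd :=
  | Skip
  | Assign of nat & expr
  | Write of nat & expr & expr    (* Write b e1 e2 : array b at index e1 := e2 *)
  | Seq of cmd & cmd
  | If of expr & cmd & cmd        (* conditions hold when nonzero *)
  | While of expr & cmd.

Record state := State { regs : nat -> nat; arrs : nat -> nat -> nat }.

Definition eval_op (o : binop) (x y : nat) : nat :=
  match o with
  | Add => x + y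
  | Sub => x - y
  | Leq => x <= y
  | Eq => x == y
  end.

Fixpoint eval (s : state) (e : expr) : nat :=
  match e with
  | Lit n => n
  | Reg r => regs s r
  | Read b e1 => arrs s b (eval s e1)
  | Op o e1 e2 => eval_op o (eval s e1) (eval s e2)
  end.

Fixpoint cost (e : expr) : nat :=
  match e with
  | Lit _ | Reg _ => 1
  | Read _ e1 => (cost e1).+1
  | Op _ e1 e2 => (cost e1 + cost e2).+1
  end.

Definition set_reg (s : state) (r n : nat) : state :=
  State (fun r' => if r' == r then n else regs s r') (arrs s).

Definition set_arr (s : state) (b i n : nat) : state :=
  State (regs s)
    (fun b' i' => if (b' == b) && (i' == i) then n else arrs s b' i').

(* [exec p s s' k] : started in [s], [p] halts in [s'] after [k] elementary
   steps. *)
Inductive exec : cmd -> state -> state -> nat -> Prop :=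
  | ExecSkip s : exec Skip s s 1
  | ExecAssign s r e :
      exec (Assign r e) s (set_reg s r (eval s e)) (cost e).+1
  | ExecWrite s b e1 e2 :
      exec (Write b e1 e2) s (set_arr s b (eval s e1) (eval s e2))
        (cost e1 + cost e2).+1
  | ExecSeq s s1 s2 p1 p2 k1 k2 :
      exec p1 s s1 k1 -> exec p2 s1 s2 k2 -> exec (Seq p1 p2) s s2 (k1 + k2)
  | ExecIfTrue s s1 e p1 p2 k :
      eval s e != 0 -> exec p1 s s1 k -> exec (If e p1 p2) s s1 (cost e + k).+1
  | ExecIfFalse s s1 e p1 p2 k :
      eval s e = 0 -> exec p2 s s1 k -> exec (If e p1 p2) s s1 (cost e + k).+1
  | ExecWhileTrue s s1 s2 e p k1 k2 :
      eval s e != 0 -> exec p s s1 k1 -> exec (While e p) s1 s2 k2 ->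
      exec (While e p) s s2 (cost e + k1 + k2).+1
  | ExecWhileFalse s e p :
      eval s e = 0 -> exec (While e p) s s (cost e).+1.

(* Register 0 holds m and array 0 holds the arrival times a(t_0), ..., a(t_(m-1));
   everything else is 0. *)
Definition input_state (m : nat) (a : 'I_m -> nat) : state :=
  State (fun r => if r == 0 then m else 0)
    (fun b i => if b == 0 then oapp a 0 (insub i) else 0).

(* The circuit is read off the final state as an explicit list of gates.  With
   s the content of register 1, the nodes are the inputs 0, ..., m-1 (node i being
   labeled t_i), the gates m, ..., m+s-1 and the output m+s.  Gate m+k is an And
   gate if array 1 holds 0 at index k and an Or gate otherwise; its predecessors
   are stored at index k of arrays 2 and 3.  The predecessor of the output is in
   register 2. *)
Section OutputFormat.

Variables (m : nat) (s : state).

Let gates := regs s 1.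

Definition output_edge : rel 'I_(m + gates).+1 := fun u v =>
  if v < m then false
  else if v < m + gates then
    (u == arrs s 2 (v - m) :> nat) || (u == arrs s 3 (v - m) :> nat)
  else u == regs s 2 :> nat.

Definition output_kind (u : 'I_(m + gates).+1) : node_kind m :=
  if insub (val u) is Some i then Input i
  else if u < m + gates then
    if arrs s 1 (u - m) == 0 then AndGate else OrGate
  else Output.

Definition output_netlist : netlist m :=
  @Netlist m 'I_(m + gates).+1 output_edge output_kind.

End OutputFormat.

Import GRing.Theory.
Local Open Scope ring_scope.

Definition log2 {R : realType} (x : R) : R := ln x / ln 2.

(* Main.v *)
Require Import Defs.
From mathcomp Require Import all_boot all_order all_algebra.
From mathcomp Require Import reals exp.
From mathcomp Require Import zify ring lra.

(* For a connective c write F(c; s; t) for the c-combination of the inputs in s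
   with the alternating path on t that starts with the dual connective, so that
   the And-Or path is F(And; t_0; t_1, ..., t_(m-1)).  If l is even, then

     F(c; s; t) = F(c; s; t_0, ..., t_(l-1))
                    c F(c'; t_0, t_2, ..., t_l; t_(l+1), ...),    c' dual to c.

   With weights w_i = 2^(a_i), the formula F(c; s; t) has delay at most d if

     w(s) + d w(t minus its last element) + 2 w(last t) - w(first t) <= 2^d,

   or w(s) <= 2^d when t is empty.  Indeed, if w(s) exceeds 2^(d-1), a prefix of
   s (sorted by decreasing weight) of weight exactly 2^(d-1) is split off.
   Otherwise take l maximal such that the left factor satisfies the condition
   for d-1.  The conditions of the two factors add up to at most that of the
   whole, because one copy of w(t) is gained when d drops to d-1, and hence the
   right factor satisfies its condition as well.

   An input is duplicated only when it lies in the alternating part of a left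
   factor, so it occurs at most d-1 times.  This bounds the fanout, and also the
   size since all gates have fanout 1.  Replacing a_i by max(a_i, B) with B
   minimal such that sum_i 2^max(a_i - B, 0) < 2m makes d at most
   log2 m + log2 log2 m + O(1) without losing more than a factor 3 in the total
   weight W.

   The tasks F(c; s; t) are processed in breadth-first order, the k-th task
   being the k-th gate.  Removing a prefix takes time O(m); an alternating split
   takes time O(m d) but occurs at most m times, as it shrinks the alternating
   parts by one element in total. *)

Set Implicit Arguments.
Unset Strict Implicit.
Unset Printing Implicit Defensive.

(** * Tasks and their decompositions *)

Definition op (c x y : bool) : bool := if c then x && y else x || y.

Definition comb (c : bool) (s : seq bool) : bool :=
  if c then all id s else has id s.

(** The path starts with the dual of [c]. The value [c] on the empty sequence is neutral for [op c],
    so a task without alternating part is just the combination of its symmetric inputs. *)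
Fixpoint alt (c : bool) (t : seq bool) : bool :=
  if t is x :: t' then op (~~ c) x (alt (~~ c) t') else c.

(** For even [cut - lo] the last entry is [cut] itself: that input lies in neither alternating part
    and only becomes symmetric in the right factor. *)
Definition evens (lo cut : nat) : seq nat :=
  [seq i <- index_iota lo cut.+1 | ~~ odd (i - lo)].

Lemma opA c : associative (op c).
Proof. by case: c => [] [] [] []. Qed.

Lemma comb_cat c s1 s2 : comb c (s1 ++ s2) = op c (comb c s1) (comb c s2).
Proof. by case: c; rewrite /comb /= ?all_cat ?has_cat. Qed.

Lemma comb_perm c (v : nat -> bool) s1 s2 :
  perm_eq s1 s2 -> comb c (map v s1) = comb c (map v s2).
Proof.
move=> /perm_mem s12; rewrite /comb !all_map !has_map.
by rewrite (eq_all_r s12) (eq_has_r s12).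
Qed.

Lemma index_iota_ltn lo hi : lo < hi -> index_iota lo hi = lo :: index_iota lo.+1 hi.
Proof. by rewrite /index_iota => lt_lo; rewrite -(subnSK lt_lo). Qed.

Lemma index_iota_geq lo hi : hi <= lo -> index_iota lo hi = [::].
Proof. by rewrite /index_iota -subn_eq0 => /eqP->. Qed.

Lemma evens_step lo cut : lo + 2 <= cut -> evens lo cut = lo :: evens lo.+2 cut.
Proof.
move=> le_cut; rewrite /evens index_iota_ltn; last by lia.
rewrite index_iota_ltn /=; last by lia.
rewrite subnn subSnn /=; congr cons; apply: eq_in_filter => i.
rewrite mem_index_iota => hi; congr (~~ _).
by rewrite (_ : i - lo = (i - lo.+2).+2) /= ?negbK //; lia.
Qed.

Lemma evens1 lo : evens lo lo = [:: lo].
Proof. by rewrite /evens /index_iota subSnn /= subnn. Qed.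

(** The induction peels off two inputs x and y. With c' dual to [c], distributivity turns x c' (y c
    (A c R)) into (x c' (y c A)) c (x c' R). For [cut = lo] the left factor is empty, hence
    neutral. *)
Lemma alt_split c v lo cut hi : ~~ odd (cut - lo) -> lo <= cut -> cut < hi ->
  alt c (map v (index_iota lo hi)) =
  op c (alt c (map v (index_iota lo cut)))
       (op (~~ c) (comb (~~ c) (map v (evens lo cut)))
                  (alt (~~ c) (map v (index_iota cut.+1 hi)))).
Proof.
have [k] := ubnP (cut - lo); elim: k lo => // k IH lo ltk ev le_lo lt_hi.
move: le_lo; rewrite leq_eqVlt => /orP[/eqP eq_lo|lt_lo].
  subst cut; rewrite evens1 [index_iota lo hi]index_iota_ltn //.
  rewrite [index_iota lo lo]index_iota_geq //=.
  by case: (c) => /=; case: (v lo); rewrite /= ?andbT ?orbF ?andbF ?orbT.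
have le2 : lo + 2 <= cut by lia.
rewrite evens_step // (index_iota_ltn (lo := lo) (hi := hi)); last by lia.
rewrite (index_iota_ltn (lo := lo.+1) (hi := hi)); last by lia.
rewrite (index_iota_ltn (lo := lo) (hi := cut)); last by lia.
rewrite (index_iota_ltn (lo := lo.+1) (hi := cut)) /=; last by lia.
rewrite negbK IH; [|lia|lia|lia|lia].
rewrite -[v lo :: _]cat1s comb_cat.
move: (alt c _) (comb _ [seq v i | i <- evens _ _]) (alt (~~ c) _) => x y z.
by case: (c); rewrite /comb /=; case: (v lo); case: (v lo.+1); case: x; case: y; case: z.
Qed.

(* [Task c s lo hi d] stands for F(c; s; t_lo, ..., t_(hi-1)) with delay at most d;
   [true] is the connective And. *)
Record task := Task {
  tand : bool; tsym : seq nat; tlo : nat; thi : nat; tbud : nat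
}.

Definition tval (v : nat -> bool) (t : task) : bool :=
  op (tand t) (comb (tand t) (map v (tsym t)))
     (alt (tand t) (map v (index_iota (tlo t) (thi t)))).

Definition touches (t : task) (i : nat) : bool :=
  (i \in tsym t) || (tlo t <= i < thi t).

(* Bounds the number of occurrences of input i in the formula built for t. *)
Definition copies (t : task) (i : nat) : nat :=
  (i \in tsym t) + (tlo t <= i < thi t) * maxn 1 (tbud t).-1.

(** For a valid task this is the sum of [copies] over all inputs. A formula has one gate less than
    it has leaves, so this controls the size. *)
Definition leaves (t : task) : nat :=
  size (tsym t) + (thi t - tlo t) * maxn 1 (tbud t).-1.

Definition leaf (t : task) : bool := (size (tsym t) == 1) && (thi t <= tlo t).

(** * Weights, budgets and the condition for delay at most d *)

Section Weights.

Variables (m : nat) (b : nat -> nat).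

Definition wsum (s : seq nat) : nat := \sum_(i <- s) 2 ^ b i.

Definition heavier : rel nat := fun i j => b j <= b i.

(* Both sides are moved so that no subtraction occurs. *)
Definition fits (d : nat) (s : seq nat) (lo hi : nat) : bool :=
  if lo < hi then
    (0 < d) && (wsum s + d * (\sum_(lo <= i < hi.-1) 2 ^ b i) + 2 * 2 ^ b hi.-1
                <= 2 ^ d + 2 ^ b lo)
  else wsum s <= 2 ^ d.

Definition valid (t : task) : Prop :=
  [/\ 0 < size (tsym t), uniq (tsym t), sorted heavier (tsym t),
      {in tsym t, forall i, i < m /\ ~~ (tlo t <= i < thi t)} &
      thi t <= m /\ fits (tbud t) (tsym t) (tlo t) (thi t)].

(** The two factors are joined by one gate. The field [refines_leaf] is there because the indegree
    counts distinct predecessors: a gate must not read the same input twice. *)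
Record refines (t t1 t2 : task) : Prop := Refines {
  refines_valid1 : valid t1;
  refines_valid2 : valid t2;
  refines_bud1 : tbud t = (tbud t1).+1;
  refines_bud2 : tbud t = (tbud t2).+1;
  refines_val : forall v, tval v t = op (tand t) (tval v t1) (tval v t2);
  refines_copies : forall i, copies t1 i + copies t2 i <= copies t i;
  refines_leaves : leaves t1 + leaves t2 <= leaves t;
  refines_touches : forall i, touches t i -> touches t1 i || touches t2 i;
  refines_leaf : leaf t1 -> leaf t2 -> head 0 (tsym t1) != head 0 (tsym t2)
}.

Lemma wsum_cat s1 s2 : wsum (s1 ++ s2) = wsum s1 + wsum s2.
Proof. exact: big_cat. Qed.

Lemma wsum_cons i s : wsum (i :: s) = 2 ^ b i + wsum s.
Proof. exact: big_cons. Qed.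

Lemma wsum_perm s1 s2 : perm_eq s1 s2 -> wsum s1 = wsum s2.
Proof. exact: perm_big. Qed.

Lemma wsum_gt0 s : 0 < size s -> 0 < wsum s.
Proof. by case: s => // i s _; rewrite wsum_cons addn_gt0 expn_gt0. Qed.

Lemma wsum_mem i s : i \in s -> 2 ^ b i <= wsum s.
Proof. by move=> si; rewrite /wsum (big_rem i) //= leq_addr. Qed.

Lemma heavier_trans : transitive heavier.
Proof. by move=> y x z; rewrite /heavier => /[swap]; apply: leq_trans. Qed.

Lemma wsum_evens lo cut : wsum (evens lo cut) <= \sum_(lo <= i < cut.+1) 2 ^ b i.
Proof.
rewrite /wsum /evens big_filter [leqRHS](bigID (fun i => ~~ odd (i - lo))) /=.
exact: leq_addr.
Qed.

(** By the sorting, all weights before position [j] are multiples of the weight at [j], and so is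
    2^d. A multiple that is at most 2^d and misses it by less than one such weight equals 2^d. *)
Lemma prefix_exact s j d : sorted heavier s -> j < size s ->
  wsum (take j s) <= 2 ^ d < wsum (take j s) + 2 ^ b (nth 0 s j) ->
  b (nth 0 s j) <= d -> wsum (take j s) = 2 ^ d.
Proof.
move=> srt lt_j /andP[le_d lt_d] le_b.
have : 2 ^ b (nth 0 s j) %| wsum (take j s).
  rewrite /wsum big_seq; apply: (big_ind (fun n => _ %| n)); [exact: dvdn0|exact: dvdn_add|].
  move=> i si; apply: dvdn_exp2l; move: srt.
  rewrite -{1}(cat_take_drop j s) (drop_nth 0) // sorted_pairwise; last exact: heavier_trans.
  rewrite pairwise_cat => /andP[/allrelP/(_ i (nth 0 s j) si)] + _.
  by rewrite mem_head => /(_ isT).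
have : 2 ^ b (nth 0 s j) %| 2 ^ d by apply: dvdn_exp2l.
move=> /dvdnP[u eu] /dvdnP[v ev]; rewrite eu ev in le_d lt_d *.
have p0 : 0 < 2 ^ b (nth 0 s j) by rewrite expn_gt0.
by move: le_d lt_d; rewrite leq_pmul2r // -mulSnr ltn_pmul2r // => ? ?; congr (_ * _); lia.
Qed.

Lemma fits_alt_gt0 d s lo hi : lo < hi -> fits d s lo hi -> wsum s < 2 ^ d.
Proof.
move=> lt_lo; rewrite /fits lt_lo => /andP[d0].
have := expn_gt0 2 (b hi.-1).
have [e|ne] := eqVneq lo hi.-1; first by rewrite -e; lia.
rewrite big_ltn; last by lia.
move: (\sum_(_ <= _ < _) _) => S; case: d d0 => // d _.
by rewrite mulSn; lia.
Qed.

(** A single alternating input has a weight that is a power of two below 2^d. With more inputs and d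
    >= 3, every alternating weight is counted at least twice even after [2 ^ b lo] is cancelled; d =
    1 is contradictory, and d = 2 leaves room for two inputs of weight 1 only. *)
Lemma fits_alt_wsum d s lo hi : lo < hi -> 0 < size s -> fits d s lo hi ->
  \sum_(lo <= i < hi) 2 ^ b i <= 2 ^ d.-1.
Proof.
move=> lt_lo /wsum_gt0 s0; rewrite /fits lt_lo => /andP[d0].
have p1 := expn_gt0 2 (b hi.-1); have p2 := expn_gt0 2 (b lo).
case: hi lt_lo p1 => // hi; rewrite ltnS /= => le_lo p1 H.
rewrite big_nat_recr //=.
case: d d0 H => // d _ H /=.
move: le_lo; rewrite leq_eqVlt => /orP[/eqP e|lt_lo].
  rewrite {}e big_geq // in H *.
  rewrite add0n leq_pexp2l //; rewrite -ltnS -(ltn_exp2l _ _ (isT : 1 < 2)); lia.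
rewrite big_ltn // in H *.
move: (\sum_(_ <= _ < _) _) H => S.
case: d => [|[|d]]; first by rewrite expn1; lia.
  by rewrite (_ : 2 ^ 2 = 4) // expn1; lia.
rewrite (expnS 2 d.+2) (_ : d.+3 = d + 3); last by lia.
by rewrite mulnDl; lia.
Qed.

Lemma fits_alt_bud d s lo hi : lo.+1 < hi -> 0 < size s -> fits d s lo hi -> 1 < d.
Proof.
move=> lt_lo s0 ft; have := fits_alt_wsum (ltnW lt_lo) s0 ft.
case: d ft => [|[|d]] //; first by rewrite /fits (ltnW lt_lo).
rewrite big_ltn ?(ltnW lt_lo) // big_ltn //.
by move=> _; rewrite [2 ^ _.-1]expn0; have := expn_gt0 2 (b lo); have := expn_gt0 2 (b lo.+1); lia.
Qed.

(* Add the two conditions: the copy of each alternating input that is gained by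
   lowering the budget pays for the symmetric copies and for input cut+1. *)
Lemma fits_right d s lo cut hi s2 : lo <= cut -> cut < hi -> 0 < size s ->
  fits d.+1 s lo hi -> perm_eq s2 (evens lo cut) ->
  hi <= cut.+2 \/
    2 ^ d + 2 ^ b lo < wsum s + d * (\sum_(lo <= i < cut.+1) 2 ^ b i) + 2 * 2 ^ b cut.+1 ->
  fits d s2 cut.+1 hi.
Proof.
move=> le_lo lt_hi s0 ft /wsum_perm es2 H; rewrite /fits {}es2.
have lt_lo := leq_ltn_trans le_lo lt_hi.
have le_e := wsum_evens lo cut; have := fits_alt_wsum lt_lo s0 ft.
have bud := @fits_alt_bud _ _ _ _ _ s0 ft.
rewrite (big_cat_nat (n := cut.+1)) //=; last by lia.
case: ltnP => [lt_cut|]; last by lia.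
have -> /= : 0 < d by have := bud; lia.
case: (leqP hi cut.+2) => [le2|gt2].
  have -> : hi = cut.+2 by lia.
  by rewrite big_nat1 [\sum_(cut.+1 <= i < _.-1) _]big_geq //=; lia.
move=> _; case: H; first by lia.
move: ft; rewrite /fits lt_lo => /= ft.
rewrite (big_cat_nat (n := cut.+1) (p := hi.-1)) //= in ft; [|lia|lia].
rewrite [\sum_(cut.+1 <= i < hi.-1) _]big_ltn in ft *; last by lia.
rewrite expnS !mulSn !mulnDr !mul0n in ft *.
lia.
Qed.

End Weights.

(** * Bucket sort and the two ways of decomposing a task *)

Section Decompositions.

Variables (m : nat) (b : nat -> nat).

Fixpoint bsort (n : nat) (s : seq nat) : seq nat :=
  if n is k.+1 then [seq i <- s | b i == k] ++ bsort k s else [::].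

Lemma bsort_perm n s : perm_eq (bsort n s) [seq i <- s | b i < n].
Proof.
elim: n => [|n IH] /=; first by rewrite (eq_filter (a2 := pred0)) ?filter_pred0.
rewrite (perm_trans (perm_cat (perm_refl _) IH)) //.
rewrite perm_sym -(perm_filterC (fun i => b i == n)) -!filter_predI.
apply: perm_cat; apply/permP => p; congr count; apply: eq_filter => i /=; lia.
Qed.

Lemma bsort_sorted n s : sorted (heavier b) (bsort n s).
Proof.
rewrite sorted_pairwise; last exact: heavier_trans.
elim: n => [|n IH] //=; rewrite pairwise_cat IH andbT; apply/andP; split.
  apply/allrelP => i j; rewrite mem_filter (perm_mem (bsort_perm _ _)) mem_filter.
  by rewrite /heavier => /andP[/eqP-> _] /andP[/ltnW].
rewrite -sorted_pairwise; last exact: heavier_trans.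
have : all (fun i => b i == n) [seq i <- s | b i == n] by apply: filter_all.
elim: [seq i <- s | b i == n] => // x [|y r] //= IHr /and3P[/eqP bx /eqP byn r_n].
by rewrite /heavier bx byn leqnn; apply: IHr; rewrite /= byn eqxx.
Qed.

(** The weight is a power of two, so it suffices that it is below 2^(d+1). This holds since
    something else, an alternating part or a second symmetric input, takes a positive share of the
    budget. *)
Lemma sym_small d c s lo hi i : valid m b (Task c s lo hi d.+1) ->
  ~~ leaf (Task c s lo hi d.+1) -> i \in s -> b i <= d.
Proof.
case=> /= s0 _ _ _ [_ ft]; rewrite /leaf /= => nl si.
rewrite -ltnS -(ltn_exp2l _ _ (isT : 1 < 2)).
have le_i := wsum_mem b si.
case: (ltnP lo hi) nl => [lt_lo _|le_hi].
  exact: leq_ltn_trans le_i (fits_alt_gt0 lt_lo ft).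
rewrite andbT => s1; move: ft; rewrite /fits ltnNge le_hi /=.
rewrite (wsum_perm b (perm_to_rem si)) wsum_cons; apply: leq_trans.
rewrite -addn1 leq_add2l wsum_gt0 // size_rem //; by case: (s) s0 s1 => [|x []].
Qed.

(** Without an alternating part, [lim] reserves one symmetric input for the right factor. If the
    scan stops because the next input is too heavy, the prefix weighs exactly 2^d by [prefix_exact];
    if it stops at [lim], there is no alternating part and a single input of weight at most 2^d
    remains. *)
Lemma prefix_refines d c s lo hi j (lim := size s - (hi <= lo)) :
  valid m b (Task c s lo hi d.+1) -> ~~ leaf (Task c s lo hi d.+1) ->
  j <= lim -> wsum b (take j s) <= 2 ^ d ->
  j = lim \/ 2 ^ d < wsum b (take j s) + 2 ^ b (nth 0 s j) ->
  (hi <= lo) || (j < size s) ->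
  refines m b (Task c s lo hi d.+1) (Task c (take j s) 0 0 d)
          (Task c (drop j s) lo hi d).
Proof.
move=> vt nl le_j le_w max_j cond.
have small i := sym_small (i := i) vt nl.
case: (vt) => /= s0 us srt smem [le_hi ft].
have s2 : hi <= lo -> 1 < size s.
  by move: nl; rewrite /leaf /= => nl le; move: nl; rewrite le andbT; lia.
have lim0 : 0 < lim.
  by rewrite /lim; case: (leqP hi lo) => [le|_]; [have := s2 le|]; rewrite ?subn0 //=; lia.
have j_lt : j < size s by move: cond le_j s2; rewrite /lim; case: (leqP hi lo) => //=; lia.
(* The first input alone fits into 2^d, so a maximal prefix is not empty. *)
have j_gt0 : 0 < j.
  rewrite lt0n; apply/eqP => j0; case: max_j => [|]; first by lia.
  rewrite j0 take0 /wsum big_nil add0n ltnNge leq_pexp2l //.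
  by apply: small; apply: mem_nth; rewrite -j0.
have small_j : b (nth 0 s j) <= d by apply/small/mem_nth.
have eq_s : wsum b s = wsum b (take j s) + wsum b (drop j s).
  by rewrite -wsum_cat cat_take_drop.
have d0 : 0 < wsum b (drop j s) by apply: wsum_gt0; rewrite size_drop subn_gt0.
split=> //=.
- split=> /=.
  + by rewrite size_takel // ltnW.
  + exact: take_uniq.
  + exact: take_sorted.
  + by move=> i /mem_take /smem[-> _]; split=> //; lia.
  + by [].
- split=> /=.
  + by rewrite size_drop subn_gt0.
  + exact: drop_uniq.
  + exact: drop_sorted.
  + by move=> i /mem_drop /smem.
  split=> //.
  case: max_j => [ej|gt_w].
    have hl : hi <= lo by move: j_lt; rewrite ej /lim; case: leqP => //=; lia.
    rewrite /fits ltnNge hl /= (drop_nth 0) // drop_oversize.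
      by rewrite /wsum big_seq1 leq_pexp2l.
    by rewrite ej /lim hl /=; lia.
  have ex : wsum b (take j s) = 2 ^ d by apply: (prefix_exact srt j_lt) => //; apply/andP.
  move: ft; rewrite /fits; case: ifP => [lt_lo /andP[_]|_]; last first.
    by rewrite eq_s ex expnS; lia.
  have dd : 0 < d.
    have ft : fits b d.+1 s lo hi by case: vt => /= _ _ _ _ [].
    have := fits_alt_gt0 lt_lo ft; rewrite eq_s ex.
    case: d {vt nl le_w gt_w small small_j ex ft} => //.
    by rewrite expn0 expn1; lia.
  by rewrite dd eq_s ex mulSn expnS; lia.
- move=> v; rewrite /tval /= -{1}(cat_take_drop j s) map_cat comb_cat.
  by case: (c) => /=; rewrite ?andbT ?orbF -?andbA -?orbA.
- move=> i; rewrite /copies /= mul0n addn0.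
  rewrite addnA; apply: leq_add; last by rewrite leq_mul2l; lia.
  rewrite -[in leqRHS](cat_take_drop j s) mem_cat.
  have := us; rewrite -[s in uniq s](cat_take_drop j s) cat_uniq => /and3P[_ /hasPn/(_ i) + _].
  by rewrite /=; do 2!case: (i \in _) => //=; move=> /(_ isT).
- rewrite /leaves /= mul0n addn0 size_take size_drop j_lt.
  suff : (hi - lo) * maxn 1 d.-1 <= (hi - lo) * maxn 1 d by lia.
  by rewrite leq_mul2l; lia.
- move=> i; rewrite /touches /= -{1}(cat_take_drop j s) mem_cat.
  by case: (i \in take _ _); case: (i \in drop _ _).
- rewrite /leaf /= => /andP[+ _] /andP[+ _].
  have := us; rewrite -{1}(cat_take_drop j s) cat_uniq => /and3P[_ + _].
  case: (take j s) => [|x []] //; case: (drop j s) => [|y []] //=.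
  by rewrite orbF inE eq_sym => ->.
Qed.

Lemma mem_evens lo cut i : i \in evens lo cut -> lo <= i <= cut.
Proof. by rewrite mem_filter mem_index_iota ltnS => /andP[]. Qed.

Lemma cut_refines d c s s2 lo cut hi :
  valid m b (Task c s lo hi d.+1) -> ~~ odd (cut - lo) -> lo <= cut < hi ->
  fits b d s lo cut ->
  hi <= cut.+2 \/
    2 ^ d + 2 ^ b lo < wsum b s + d * (\sum_(lo <= i < cut.+1) 2 ^ b i) + 2 * 2 ^ b cut.+1 ->
  perm_eq s2 (evens lo cut) -> sorted (heavier b) s2 ->
  refines m b (Task c s lo hi d.+1) (Task c s lo cut d)
          (Task (~~ c) s2 cut.+1 hi d).
Proof.
move=> [/= s0 us srt smem [le_hi ft]] ev /andP[le_lo lt_hi] ft1 max_cut p2 srt2.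
have mem2 i : i \in s2 -> lo <= i <= cut by rewrite (perm_mem p2) => /mem_evens.
have s2_0 : 0 < size s2.
  have : lo \in s2.
    by rewrite (perm_mem p2) mem_filter mem_index_iota subnn leqnn ltnS.
  by case: (s2).
(* A positive even [cut - lo] leaves at least two alternating inputs on the left. Then [maxn 1 d] is
   one more than [maxn 1 d.-1], which pays for the symmetric copy of an input that also stays in the
   left alternating part. *)
have bud2 : lo < cut -> 1 < d.
  move=> lt_lo; apply: fits_alt_bud ft1 => //.
  by move: ev lt_lo; case: (ltngtP lo.+1 cut) => //; lia.
split=> //=.
- split=> //=.
  + by move=> i /smem[-> ?]; split=> //; lia.
  + by split=> //; lia.
- split=> //=.
  + by rewrite (perm_uniq p2) filter_uniq // iota_uniq.
  + by move=> i /mem2; lia.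
  + by split=> //; apply: fits_right ft p2 _.
- by move=> v; rewrite /tval /= (alt_split c v ev le_lo lt_hi) opA (comb_perm _ _ p2).
- move=> i; rewrite /copies /=.
  have := mem2 i; case: (i \in s2) => [/(_ isT)|_] /=; last first.
    rewrite add0n -addnA leq_add2l; case: (ltnP i cut) => ic.
      rewrite [cut < i]ltnNge (ltnW ic) /= addn0.
      by case: (leqP lo i) => //= _; rewrite (ltn_trans ic lt_hi) /=; lia.
    by rewrite andbF mul0n add0n; case: (ltnP cut i) => //= ci; lia.
  move=> /andP[lo_i i_cut]; rewrite lo_i /= [cut < i]ltnNge i_cut /= (leq_ltn_trans i_cut lt_hi).
  by case: (ltnP i cut) => /= ic; [have := bud2 (leq_ltn_trans lo_i ic) | ]; lia.
- rewrite /leaves /= (perm_size p2).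
  have : size (evens lo cut) <= cut.+1 - lo.
    by rewrite /evens size_filter (leq_trans (count_size _ _)) // size_iota.
  move: bud2; move: (size (evens _ _)) => n bud2 le_n.
  have [e|lt_lo] := eqVneq lo cut.
    rewrite -e subnn mul0n addn0 leq_add2l.
    rewrite -e in le_n lt_hi *.
    have -> : hi - lo = (hi - lo.+1).+1 by lia.
    by rewrite mulSn leq_add ?leq_mul2l; lia.
  have {}lt_lo : lo < cut by lia.
  have -> : maxn 1 d = (maxn 1 d.-1).+1 by have := bud2 lt_lo; lia.
  have -> : hi - lo = (cut - lo) + (hi - cut.+1).+1 by lia.
  rewrite !mulnDl !mulnS !mulSn; lia.
- move=> i; rewrite /touches /= => /orP[->//|/andP[lo_i i_hi]].
  rewrite lo_i i_hi /= andbT; case: (ltngtP i cut) => [|_|->]; rewrite ?orbT //.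
  rewrite (perm_mem p2) mem_filter ev mem_index_iota le_lo ltnSn /=.
  by rewrite orbT.
- rewrite /leaf /= => /andP[/eqP s1 _] _.
  have h1 : head 0 s \in s by case: (s) s1 => //= x r _; rewrite mem_head.
  have h2 : head 0 s2 \in s2 by case: (s2) s2_0 => //= x r _; rewrite mem_head.
  by apply/eqP => e; have := mem2 _ h2; have [_] := smem _ h1; rewrite e; lia.
Qed.

End Decompositions.

(** * Netlists described by a list of tasks *)

(** The two path functions call each other, so one induction treats both. On the empty sequence
    [and_or_path] is [true] but [alt false] is [false], hence the side condition. *)
Lemma and_or_path_alt s :
  (s != [::] -> and_or_path s = alt false s) /\ or_and_path s = alt true s.
Proof.
elim: s => // x [|y s] [IH1 IH2]; split=> // [_|]; first by rewrite /= andbT.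
- by rewrite /= orbF.
- by rewrite -[LHS]/(x && or_and_path (y :: s)) IH2.
- by rewrite -[LHS]/(x || and_or_path (y :: s)) IH1.
Qed.

Lemma tval_root m (t : m.-tuple bool) d : 0 < m ->
  tval (nth false t) (Task true [:: 0] 1 m d) = and_or_path t.
Proof.
move=> m0; rewrite (and_or_path_alt t).1 -?size_eq0 ?size_tuple -?lt0n //.
rewrite /tval /= andbT -[in RHS](mkseq_nth false t) size_tuple /mkseq.
by rewrite -[X in iota 0 X](prednK m0) /index_iota subn1.
Qed.

Section Netlist.

Variables (m : nat) (s : state) (b : nat -> nat) (q : nat -> task) (F d0 : nat).
Local Notation g := (regs s 1).
Local Notation c := (output_netlist m s).

Definition refs (n r : nat) : nat :=
  \sum_(0 <= k < n) ((arrs s 2 k == r) + (arrs s 3 k == r)).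

(** Children that are gates have larger numbers than their parent; the condition [k < j] is what
    makes the netlist acyclic. *)
Definition linked (n k r : nat) (t : task) : Prop :=
  leaf t /\ r = head 0 (tsym t) \/ exists j, [/\ r = m + j, k < j < n & q j = t].

Hypothesis g_gt0 : 0 < g.
Hypothesis root_ref : regs s 2 = m.
Hypothesis kindP : forall k, k < g -> (arrs s 1 k == 0) = tand (q k).
Hypothesis childP : forall k, k < g -> exists t1 t2,
  [/\ refines m b (q k) t1 t2, linked g k (arrs s 2 k) t1 & linked g k (arrs s 3 k) t2].
Hypothesis gate_refs : forall j, j < g -> refs g (m + j) = (0 < j).
Hypothesis input_refs : forall i, i < m -> 0 < refs g i <= F.
Hypothesis F_gt0 : 0 < F.
Hypothesis bud0 : tbud (q 0) = d0.

Lemma leaf_head t : valid m b t -> leaf t ->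
  head 0 (tsym t) < m /\ b (head 0 (tsym t)) <= tbud t.
Proof.
case: t => [k [|i [|//]] lo hi d] [//= _ _ _ mem [_ ft]] /andP[_ /= le_hi].
have [lt_i _] := mem i (mem_head _ _); split=> //; move: ft.
by rewrite /fits ltnNge le_hi /= /wsum big_seq1 leq_exp2l.
Qed.

Lemma linked_bound k r t : k < g -> valid m b t -> linked g k r t -> r < m + g.
Proof.
move=> lt_k vt [[lf ->]|[j [-> /andP[_ lt_j] _]]]; last by rewrite ltn_add2l.
by rewrite ltn_addr //; case: (leaf_head vt lf).
Qed.

(** Two leaves differ by [refines_leaf]. A gate read twice by gate [k] would contribute 2 to [refs],
    whereas every gate is referenced at most once. *)
Lemma child_neq k : k < g -> arrs s 2 k != arrs s 3 k.
Proof.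
move=> lt_k; have [t1 [t2 [rf l1 l2]]] := childP lt_k.
have v1 := refines_valid1 rf; have v2 := refines_valid2 rf.
apply/eqP => e; have [le1|gt1] := ltnP (arrs s 2 k) m.
  case: l1 => [[lf1 e1]|[j [e1 _ _]]]; last by lia.
  case: l2 => [[lf2 e2]|[j [e2 _ _]]]; last by lia.
  by move: (refines_leaf rf lf1 lf2); rewrite -e1 -e2 e eqxx.
case: l1 => [[lf1 e1]|[j [e1 /andP[_ lt_j] _]]].
  by have := (leaf_head v1 lf1).1; lia.
have := gate_refs lt_j; rewrite /refs (big_rem k) ?mem_index_iota //=.
by rewrite -e e1 eqxx; case: (0 < j).
Qed.

Lemma child_bound k : k < g -> arrs s 2 k < m + g /\ arrs s 3 k < m + g.
Proof.
move=> lt_k; have [t1 [t2 [rf l1 l2]]] := childP lt_k.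
by split; [apply: linked_bound l1 | apply: linked_bound l2] => //; case: rf.
Qed.

Lemma child_rank k r : k < g -> r = arrs s 2 k \/ r = arrs s 3 k ->
  r < m \/ m + k < r.
Proof.
move=> lt_k; have [t1 [t2 [rf l1 l2]]] := childP lt_k.
have v1 := refines_valid1 rf; have v2 := refines_valid2 rf.
case=> ->.
  case: l1 => [[lf ->]|[j [-> /andP[kj _] _]]]; last by right; rewrite ltn_add2l.
  by left; case: (leaf_head v1 lf).
case: l2 => [[lf ->]|[j [-> /andP[kj _] _]]]; last by right; rewrite ltn_add2l.
by left; case: (leaf_head v2 lf).
Qed.

Let N := (m + g).+1.

Lemma edgeE (u v : 'I_N) : @edge m c u v = output_edge u v.
Proof. by []. Qed.

Variant node_spec (v : 'I_N) : node_kind m -> bool -> bool -> Type :=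
  | NodeInput (i : 'I_m) of v = i :> nat : node_spec v (Input i) true true
  | NodeGate k of k < g & v = m + k :> nat :
      node_spec v (if tand (q k) then AndGate else OrGate) false true
  | NodeOutput of v = m + g :> nat : node_spec v Output false false.

Lemma nodeP v : node_spec v (output_kind v) (v < m) (v < m + g).
Proof.
rewrite /output_kind; case: insubP => [i lt_v /= eq_v|].
  by rewrite lt_v ltn_addr //; constructor.
rewrite -leqNgt => /= le_v; rewrite (ltnNge v m) le_v /=.
case: ltnP => [lt_v|ge_v]; last first.
  by constructor; apply/eqP; rewrite eqn_leq ge_v -ltnS ltn_ord.
have lt_k : v - m < g by rewrite ltn_subLR.
by rewrite kindP //; constructor=> //; rewrite subnKC.
Qed.

Lemma edge_gate (u v : 'I_N) k : v = m + k :> nat -> k < g ->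
  output_edge u v = (u == arrs s 2 k :> nat) || (u == arrs s 3 k :> nat).
Proof. by rewrite /output_edge => -> lt_k; rewrite ltnNge leq_addr /= ltn_add2l lt_k addKn. Qed.

Lemma edge_output (u v : 'I_N) : v = m + g :> nat ->
  output_edge u v = (u == m :> nat).
Proof. by rewrite /output_edge => ->; rewrite ltnNge leq_addr /= ltnn root_ref. Qed.

Lemma edge_input (u v : 'I_N) : v < m -> output_edge u v = false.
Proof. by rewrite /output_edge => ->. Qed.

Lemma indegreeE (v : 'I_N) : @indegree m c v =
  match output_kind v with Input _ => 0 | AndGate | OrGate => 2 | Output => 1 end.
Proof.
rewrite /indegree; case: (nodeP v) => [i ev|k lt_k ev|ev].
- by apply: eq_card0 => u; rewrite !inE edgeE edge_input // ev.
- have [b2 b3] := child_bound lt_k.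
  pose o2 : 'I_N := Ordinal (ltnW b2 : arrs s 2 k < N).
  pose o3 : 'I_N := Ordinal (ltnW b3 : arrs s 3 k < N).
  rewrite (eq_card (B := [set o2; o3])); last first.
    by move=> u; rewrite !inE edgeE (edge_gate _ ev lt_k).
  by rewrite cards2 -val_eqE /= (child_neq lt_k); case: (tand _).
- have om : m < N by rewrite ltnS leq_addr.
  rewrite (eq_card (B := pred1 (Ordinal om))) ?card1 // => u.
  by rewrite !inE edgeE edge_output.
Qed.

Lemma outdegreeE (u : 'I_N) : @outdegree m c u =
  if u < m + g then refs g u + (u == m :> nat) else 0.
Proof.
have -> : @outdegree m c u = refs g u + (u == m :> nat).
  rewrite /outdegree -sum1_card big_mkcond /=.
  rewrite (eq_bigr (fun v : 'I_N => output_edge u v : nat)); last first.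
    by move=> v _; rewrite inE; case: (output_edge u v).
  rewrite big_ord_recr /= edge_output //; congr (_ + _).
  rewrite big_split_ord /= big1 ?add0n => [|i _]; last by rewrite edge_input /=.
  rewrite /refs big_mkord; apply: eq_bigr => k _.
  rewrite (@edge_gate _ _ k) //= (eq_sym _ (arrs s 2 k)) (eq_sym _ (arrs s 3 k)).
  have := child_neq (ltn_ord k); case: (eqVneq (arrs s 2 k) u) => [->|] //.
  by rewrite eq_sym => /negbTE->.
case: ifP => // /negbT; rewrite -leqNgt => le_u.
rewrite /refs big_nat big1 => [|k /andP[_ lt_k]].
  by rewrite gtn_eqF // (leq_trans _ le_u) // -addn1 leq_add2l.
by have [? ?] := child_bound lt_k; rewrite !ltn_eqF // (leq_trans _ le_u).
Qed.

(** A potential that increases strictly along edges. Gates are ranked against their numbering,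
    because the predecessors of a gate are inputs or gates of larger number. *)
Let rank (u : nat) : nat :=
  if u < m then 0 else if u < m + g then m + g - u else g.+1.

Lemma edge_rank (u v : 'I_N) : output_edge u v -> rank u < rank v.
Proof.
rewrite /rank; have := ltn_ord v; have := ltn_ord u; case: (nodeP v) => [i ev|k lt_k ev|ev].
- by rewrite edge_input // ev.
- rewrite (edge_gate _ ev lt_k) => _ _ /orP uk.
  have [b2 b3] := child_bound lt_k.
  have : u < m \/ m + k < u by apply: (child_rank lt_k); case: uk => /eqP; auto.
  have : u < m + g by case: uk => /eqP->.
  by rewrite ev => ->; case: ltnP; lia.
- by move=> _ _; rewrite edge_output // => /eqP->; rewrite ltnn /=; case: (ltnP m (m + g)); lia.
Qed.

Lemma is_circuitP : is_circuit c.
Proof.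
split.
- move=> u v /edge_rank lt_uv; apply/negP => /connectP[p].
  elim: p v lt_uv => [|w p IH] v lt_uv /=; first by move=> _ e; rewrite e ltnn in lt_uv.
  by case/andP=> /edge_rank lt_vw pw; apply: IH => //; apply: ltn_trans lt_vw.
- exact: indegreeE.
- move=> u; rewrite outdegreeE /is_output /=; case: (nodeP u) => [i eu|k lt_k eu|] //.
    rewrite eu addn_eq0; have := input_refs (ltn_ord i).
    by case: (refs g i).
  rewrite eu gate_refs //; case: k {lt_k eu} => [|k]; rewrite ?addn0 ?eqxx //=;
    by case: (tand _).
- exists (Ordinal (ltnSn (m + g))); split.
    rewrite /is_output /=; case: nodeP => [i /= ei|k lt_k /= ek|] //; last by move: ek lt_k; lia.
    by have := ltn_ord i; lia.
  move=> u; rewrite /is_output /=; case: nodeP => // [k|eu _]; first by case: (tand _).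
  by apply: val_inj.
- move=> u v i /=; case: nodeP => // [j eu [ej]|k]; last by case: (tand _).
  case: nodeP => // [j' ev [ej']|k]; last by case: (tand _).
  by apply: val_inj; rewrite /= eu ev ej ej'.
Qed.

Lemma is_gateE (u : 'I_N) : @is_gate m c u = (m <= u < m + g).
Proof.
rewrite /is_gate /= leqNgt; case: (nodeP u) => //= k _ _.
by case: (tand _).
Qed.

Lemma size_ofE : size_of c = g.
Proof.
rewrite /size_of -sum1_card big_mkcond /= big_ord_recr /= big_split_ord /=.
rewrite !inE is_gateE /= ltnn andbF addn0 big1 => [|i _]; last first.
  by rewrite inE is_gateE /= leqNgt ltn_ord.
rewrite (eq_bigr (fun=> 1)) => [|i _]; first by rewrite sum1_card card_ord.
by rewrite inE is_gateE /= leq_addr ltn_add2l ltn_ord.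
Qed.

Lemma max_fanout_le : max_fanout c <= F.
Proof.
apply/bigmax_leqP => u; rewrite /is_output /= outdegreeE.
case: (nodeP u) => // [i eu|k lt_k eu] _.
  by rewrite eu ltn_eqF // addn0; case/andP: (input_refs (ltn_ord i)).
rewrite eu gate_refs // -{2}(addn0 m) eqn_add2l; by case: k {lt_k eu}.
Qed.

Lemma realizesP f : (forall t : m.-tuple bool, tval (nth false t) (q 0) = f t) ->
  realizes c f.
Proof.
move=> root t.
(* Each gate carries the value of its task, and the output that of the root task. *)
pose x (u : 'I_N) := if u < m then nth false t u else
  if u < m + g then tval (nth false t) (q (u - m)) else tval (nth false t) (q 0).
exists x => [u|u]; last first.
  by rewrite /is_output /= /x; case: (nodeP u) => // k _ _; case: (tand _).
have xl k r tk (o : 'I_N) : k < g -> valid m b tk -> linked g k r tk ->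
    o = r :> nat -> x o = tval (nth false t) tk.
  move=> lt_k vt lk eo; rewrite /x eo.
  case: lk => [[lf er]|[j [-> /andP[_ lt_j] <-]]]; last first.
    by rewrite ltnNge leq_addr /= ltn_add2l lt_j addKn.
  rewrite er (leaf_head vt lf).1.
  case: tk lf {vt er} => kk [|i []] lo hi d //= /andP[_ /= le_hi].
  rewrite /tval /= index_iota_geq //=.
  by case: kk; rewrite /comb /= ?andbT ?orbF.
have step k (o : 'I_N) : k < g -> o = m + k :> nat -> x o =
    if tand (q k) then [forall w : 'I_N, output_edge w o ==> x w]
    else [exists w : 'I_N, output_edge w o && x w].
  move=> lt_k eo; have [t1 [t2 [rf l1 l2]]] := childP lt_k.
  have [b2 b3] := child_bound lt_k.
  pose o2 : 'I_N := Ordinal (ltnW b2 : arrs s 2 k < N).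
  pose o3 : 'I_N := Ordinal (ltnW b3 : arrs s 3 k < N).
  have x2 := xl k _ _ o2 lt_k (refines_valid1 rf) l1 erefl.
  have x3 := xl k _ _ o3 lt_k (refines_valid2 rf) l2 erefl.
  have edg w : output_edge w o = (w == o2) || (w == o3) by rewrite (edge_gate _ eo lt_k).
  have -> : x o = tval (nth false t) (q k).
    by rewrite /x eo ltnNge leq_addr /= ltn_add2l lt_k addKn.
  rewrite (refines_val rf) -x2 -x3; case: (tand (q k)) => /=.
    apply/andP/forallP => [[h2 h3] w|h].
      by rewrite edg; apply/implyP => /orP[] /eqP->.
    by split; [have := h o2 | have := h o3]; rewrite edg eqxx ?orbT.
  apply/orP/existsP => [[h|h]|[w /andP[]]].
  - by exists o2; rewrite edg eqxx.
  - by exists o3; rewrite edg eqxx orbT.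
  - by rewrite edg => /orP[] /eqP->; auto.
rewrite /=; case: (nodeP u) => [i eu|k lt_k eu|eu].
- by rewrite /x eu ltn_ord (tnth_nth false).
- by rewrite (step k) //; case: (tand _).
- have om : m < N by rewrite ltnS leq_addr.
  transitivity (x (Ordinal om)).
    have mg : m < m + g by rewrite -addn1 leq_add2l.
    by rewrite /x /= eu [m + g < m]ltnNge leq_addr !ltnn /= subnn mg.
  apply/idP/existsP => [h|[w]].
    by exists (Ordinal om); rewrite /= edge_output ?eqxx.
  by rewrite edge_output // => /andP[/eqP ew]; congr (x _); apply: val_inj.
Qed.

Lemma linked_bud k t1 t2 r : k < g -> refines m b (q k) t1 t2 ->
  linked g k r t1 \/ linked g k r t2 ->
  (r < m -> b r < tbud (q k)) /\ (forall j, r = m + j -> tbud (q k) = (tbud (q j)).+1).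
Proof.
move=> lt_k rf; have v1 := refines_valid1 rf; have v2 := refines_valid2 rf.
have aux t : tbud (q k) = (tbud t).+1 -> valid m b t -> linked g k r t ->
    (r < m -> b r < tbud (q k)) /\ (forall j, r = m + j -> tbud (q k) = (tbud (q j)).+1).
  move=> eb vt; case=> [[lf ->]|[j [-> _ ej]]].
    by have [h1 h2] := leaf_head vt lf; rewrite eb ltnS; split=> // j; lia.
  by split; [lia | move=> j' /addnI <-; rewrite ej].
by case; apply: aux => //; case: rf.
Qed.

Lemma edge_bud (u v : 'I_N) k : v = m + k :> nat -> k < g -> output_edge u v ->
  (u < m -> b u < tbud (q k)) /\
  (forall j, u = m + j :> nat -> tbud (q k) = (tbud (q j)).+1).
Proof.
move=> ev lt_k; rewrite (edge_gate _ ev lt_k) => /orP e.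
have [t1 [t2 [rf l1 l2]]] := childP lt_k.
by apply: (linked_bud lt_k rf); case: e => /eqP->; auto.
Qed.

(** Along an edge between gates the budget grows by exactly one, and no budget exceeds [d0]. *)
Lemma path_gates (u : 'I_N) k p : u = m + k :> nat -> k < g ->
  path (@edge m c) u p -> count (@is_gate m c) (u :: p) + tbud (q k) <= d0.+1.
Proof.
elim: p u k => [|v p IH] u k eu lt_k /=.
  rewrite is_gateE eu leq_addr ltn_add2l lt_k /= addn0 add1n ltnS => _.
  elim/ltn_ind: k lt_k {u eu} => k IHk lt_k.
  case: k lt_k IHk => [|k] lt_k IHk; first by rewrite bud0.
  have : 0 < refs g (m + k.+1) by rewrite gate_refs.
  (* If the budget of this gate exceeded [d0], a gate referring to it would have a smaller number
     and a still larger budget, against the induction hypothesis. So there would be no reference at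
     all. *)
  rewrite lt0n; apply: contraNT; rewrite -ltnNge => gt_d.
  rewrite /refs big_nat big1 // => j /andP[_ lt_j].
  have [t1 [t2 [rf l1 l2]]] := childP lt_j.
  apply/eqP; rewrite addn_eq0 !eqb0; apply/andP; split; apply/eqP => e.
    have := (linked_bud lt_j rf (or_introl l1)).2 _ e.
    have : m + k.+1 < m \/ m + j < m + k.+1 by apply: child_rank lt_j _; auto.
    rewrite ltn_add2l => -[|jk eb]; first by lia.
    by have := IHk j jk lt_j; lia.
  have := (linked_bud lt_j rf (or_intror l2)).2 _ e.
  have : m + k.+1 < m \/ m + j < m + k.+1 by apply: child_rank lt_j _; auto.
  rewrite ltn_add2l => -[|jk eb]; first by lia.
  by have := IHk j jk lt_j; lia.
case/andP=> euv pv.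
have gu : @is_gate m c u by rewrite is_gateE eu leq_addr ltn_add2l lt_k.
case: (nodeP v) => [i ev|j lt_j ev|ev].
- by move: euv; rewrite ?edgeE edge_input // ev.
- have := IH v j ev lt_j pv; rewrite /= gu.
  by have [_ /(_ k eu)] := edge_bud ev lt_j euv; lia.
- have ek : k = 0 by move: euv; rewrite ?edgeE edge_output // eu => /eqP; lia.
  case: p IH pv => [|w p] _ /=.
    by rewrite gu is_gateE ev ltnn andbF /= addn0 ek bud0 add1n.
  case/andP=> /edge_rank; rewrite /rank ev ltnn [m + g < m]ltnNge leq_addr /=.
  by have := ltn_ord w; case: ifP => //; case: ifP => //; lia.
Qed.

(** Truncation gives [a i <= B + b i]. An input is read only by gates of budget greater than [b i],
    so by [path_gates] at most [d0 - b i] gates follow it on a path. *)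
Lemma delay_le (a : 'I_m -> nat) B : (forall i : 'I_m, b i = a i - B) ->
  delay c a <= B + d0.
Proof.
move=> ab; apply/bigmax_leqP => u _ /=.
case: (nodeP u) => // [i eu|k _ _]; last by case: (tand _).
have bi : b i <= d0.
  have /andP[+ _] := input_refs (ltn_ord i).
  rewrite lt0n; apply: contraNT; rewrite -ltnNge => gt_d.
  rewrite /refs big_nat big1 // => k /andP[_ lt_k].
  have [t1 [t2 [rf l1 l2]]] := childP lt_k.
  (* For a path of one gate, [path_gates] says that the budget of gate [k] is at most [d0]. *)
  have : count (@is_gate m c) [:: inord (m + k) : 'I_N] + tbud (q k) <= d0.+1.
    by apply: path_gates => //; rewrite inordK // ltnS leq_add2l ltnW.
  rewrite /= is_gateE inordK; last by rewrite ltnS leq_add2l ltnW.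
  rewrite leq_addr ltn_add2l lt_k => le_d.
  apply/eqP; rewrite addn_eq0 !eqb0; apply/andP; split; apply/eqP => e.
    by have := (linked_bud lt_k rf (or_introl l1)).1; rewrite e ltn_ord => /(_ isT); lia.
  by have := (linked_bud lt_k rf (or_intror l2)).1; rewrite e ltn_ord => /(_ isT); lia.
suff : @max_gates m c u + b i <= d0 by rewrite ab in bi *; lia.
suff : @max_gates m c u <= d0 - b i by lia.
apply/bigmax_leqP => n _; apply/bigmax_leqP => -[[|v p] sp] /=;
  rewrite is_gateE eu [m <= i]leqNgt ltn_ord //=.
case/andP=> euv pv; case: (nodeP v) => [j ev|k lt_k ev|ev].
- by move: euv; rewrite ?edgeE edge_input // ev.
- have /= := path_gates ev lt_k pv; have [+ _] := edge_bud ev lt_k euv.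
  by rewrite eu => /(_ (ltn_ord i)); lia.
- by move: euv; rewrite ?edgeE edge_output // eu ltn_eqF.
Qed.

End Netlist.

(** * Program logic for the random access machine *)

(** Total correctness with running time: the existence of a halting run is part of the claim, and
    [Q] also receives its number of steps. *)
Definition wp (p : cmd) (s : state) (Q : state -> nat -> Prop) : Prop :=
  exists s' k, exec p s s' k /\ Q s' k.

Lemma wp_conseq p s (Q Q' : state -> nat -> Prop) :
  wp p s Q -> (forall s' k, Q s' k -> Q' s' k) -> wp p s Q'.
Proof. by case=> s' [k [e q]] QQ'; exists s', k; split; last exact: QQ'. Qed.

Lemma wp_skip s (Q : state -> nat -> Prop) : Q s 1 -> wp Skip s Q.
Proof. by exists s, 1; split=> //; constructor. Qed.

Lemma wp_assign r e s (Q : state -> nat -> Prop) :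
  Q (set_reg s r (eval s e)) (cost e).+1 -> wp (Assign r e) s Q.
Proof. by move=> q; do 2!eexists; split; [constructor|]. Qed.

Lemma wp_write x e1 e2 s (Q : state -> nat -> Prop) :
  Q (set_arr s x (eval s e1) (eval s e2)) (cost e1 + cost e2).+1 ->
  wp (Write x e1 e2) s Q.
Proof. by move=> q; do 2!eexists; split; [constructor|]. Qed.

Lemma wp_seq p1 p2 s (Q : state -> nat -> Prop) :
  wp p1 s (fun s1 k1 => wp p2 s1 (fun s2 k2 => Q s2 (k1 + k2))) ->
  wp (Seq p1 p2) s Q.
Proof.
case=> s1 [k1 [e1 [s2 [k2 [e2 q]]]]]; exists s2, (k1 + k2); split=> //.
exact: ExecSeq e1 e2.
Qed.

Lemma wp_if e p1 p2 s (Q : state -> nat -> Prop) :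
  (eval s e != 0 -> wp p1 s (fun s' k => Q s' (cost e + k).+1)) ->
  (eval s e = 0 -> wp p2 s (fun s' k => Q s' (cost e + k).+1)) ->
  wp (If e p1 p2) s Q.
Proof.
have [e0 _ /(_ e0)|ne0 /(_ isT) + _] := eqVneq (eval s e) 0.
  by case=> s' [k [ex q]]; exists s', (cost e + k).+1; split; first exact: ExecIfFalse.
by case=> s' [k [ex q]]; exists s', (cost e + k).+1; split; first exact: ExecIfTrue.
Qed.

(* The index of the invariant is a potential that pays for the iterations to come. *)
Lemma wp_while (I : nat -> state -> Prop) e p v s :
  (forall v s, I v s -> eval s e != 0 ->
     wp p s (fun s' k => exists v', I v' s' /\ k + (cost e).+1 + v' <= v)) ->
  I v s ->
  wp (While e p) s (fun s' k =>
    exists v', [/\ I v' s', eval s' e = 0 & k + v' <= v + (cost e).+1]).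
Proof.
move=> step; have [n] := ubnP v; elim: n v s => // n IH v s ltv Iv.
have [e0|ne0] := eqVneq (eval s e) 0.
  by exists s, (cost e).+1; split; [exact: ExecWhileFalse | exists v; split=> //; lia].
have [s1 [k1 [ex1 [v1 [Iv1 le1]]]]] := step _ _ Iv ne0.
have [|s2 [k2 [ex2 [v2 [Iv2 e2 le2]]]]] := IH v1 s1 _ Iv1; first by lia.
exists s2, (cost e + k1 + k2).+1; split; first exact: ExecWhileTrue ex1 ex2.
by exists v2; split=> //; lia.
Qed.

Definition For (r : nat) (e : expr) (p : cmd) : cmd :=
  While (Op Leq (Op Add (Reg r) (Lit 1)) e)
    (Seq p (Assign r (Op Add (Reg r) (Lit 1)))).

(** Besides the body, an iteration pays for the test and the increment, together [cost e + 9]. The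
    same amount is added once more to cover the final failing test. *)
Lemma wp_for (I : nat -> state -> Prop) r e p n T i s :
  (forall j s, j <= n -> I j s -> regs s r = j /\ eval s e = n) ->
  (forall j s, j < n -> I j s ->
     wp p s (fun s' k => I j.+1 (set_reg s' r (regs s' r + 1)) /\ k <= T)) ->
  i <= n -> I i s ->
  wp (For r e p) s (fun s' k => I n s' /\ k <= (n - i) * (T + cost e + 9) + cost e + 9).
Proof.
move=> head body le_i Ii.
pose J v s := exists j, [/\ j <= n, I j s & v = (n - j) * (T + cost e + 9)].
apply: (wp_conseq (Q := fun s' k => exists v', [/\ J v' s',
    eval s' (Op Leq (Op Add (Reg r) (Lit 1)) e) = 0 &
    k + v' <= (n - i) * (T + cost e + 9) + (cost (Op Leq (Op Add (Reg r) (Lit 1)) e)).+1])).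
  apply: wp_while; last by exists i.
  move=> v s1 [j [le_j Ij ->]]; have [ej en] := head _ _ le_j Ij.
  rewrite /= ej en addn1 eqb0 negbK => lt_j; apply: wp_seq.
  apply: wp_conseq (body _ _ lt_j Ij) _ => s2 k2 [Ij2 le_k]; apply: wp_assign.
  exists ((n - j.+1) * (T + cost e + 9)); split; first by exists j.+1.
  by rewrite (_ : n - j = (n - j.+1).+1) ?mulSn; [rewrite /=|]; lia.
move=> s' k [v' [[j [le_j Ij ->]] + le_k]]; have [ej en] := head _ _ le_j Ij.
rewrite /= ej en addn1 => /eqP; rewrite eqb0 -ltnNge ltnS => ge_j.
have ej' : j = n by lia.
by rewrite ej' in Ij le_k; split=> //; move: le_k => /=; lia.
Qed.

Lemma state_ext s1 s2 : (forall r, regs s1 r = regs s2 r) ->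
  (forall x i, arrs s1 x i = arrs s2 x i) -> s1 = s2.
Proof.
case: s1 s2 => [r1 a1] [r2 a2] /= er ea; congr State; apply: boolp.funext => // x.
by apply: boolp.funext => i; apply: ea.
Qed.

(** Registers 0, 1 and 2 are fixed by the input and output formats. [rB] holds B, [rD] the largest
    exponent tabulated in [aPow], [rK] the number of the current task, [rC] to [rd] its fields ([rd]
    being its budget minus one), and [nC] to [nHi] the fields of a child. Symmetric parts are slices
    of [aHeap] with start in [aSp] and length in [aSl]; [rHp] is the first free heap cell. *)
Local Notation rI := 3 (only parsing).
Local Notation rA := 4 (only parsing).
Local Notation rB := 5 (only parsing).
Local Notation rD := 6 (only parsing).
Local Notation rS := 7 (only parsing).
Local Notation rY := 8 (only parsing).
Local Notation rK := 9 (only parsing).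
Local Notation rC := 10 (only parsing).
Local Notation rSp := 11 (only parsing).
Local Notation rSl := 12 (only parsing).
Local Notation rLo := 13 (only parsing).
Local Notation rHi := 14 (only parsing).
Local Notation rd := 15 (only parsing).
Local Notation rAcc := 16 (only parsing).
Local Notation rJ := 17 (only parsing).
Local Notation rCut := 18 (only parsing).
Local Notation rX := 19 (only parsing).
Local Notation rE := 20 (only parsing).
Local Notation rQ := 21 (only parsing).
Local Notation rHp := 22 (only parsing).
Local Notation rP := 23 (only parsing).
Local Notation nC := 24 (only parsing).
Local Notation nSp := 25 (only parsing).
Local Notation nSl := 26 (only parsing).
Local Notation nLo := 27 (only parsing).
Local Notation nHi := 28 (only parsing).
Local Notation aPow := 4 (only parsing).
Local Notation aHeap := 5 (only parsing).
Local Notation aSp := 6 (only parsing).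
Local Notation aSl := 7 (only parsing).
Local Notation aLo := 8 (only parsing).
Local Notation aHi := 9 (only parsing).
Local Notation aBud := 10 (only parsing).

Declare Scope expr_scope.
Delimit Scope expr_scope with X.
Bind Scope expr_scope with expr.
Local Notation "x + y" := (Op Add x y) : expr_scope.
Local Notation "x - y" := (Op Defs.Sub x y) : expr_scope.
Local Notation "x <= y" := (Op Leq x y) : expr_scope.
Local Notation "x == y" := (Op Eq x y) : expr_scope.
Local Notation "'$' r" := (Reg r) (at level 5, r at level 0, format "'$' r") : expr_scope.
Local Notation "'#' n" := (Lit n) (at level 5, n at level 0, format "'#' n") : expr_scope.
Local Notation "r ::= e" := (Assign r e%X) (at level 70).
Local Notation "a @ i ::= e" := (Write a i%X e%X) (at level 70, i at level 5).
Local Notation "p ;; q" := (Seq p q) (at level 80, right associativity).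

(** * The algorithm *)

(** Truncated subtraction yields the exponent max(a_i, B) - B of the scaled weight. The power itself
    is looked up in a table, as shifts are not elementary. *)
Definition bE (i : expr) : expr := (Read 0 i - $rB)%X.
Definition wE (i : expr) : expr := Read aPow (bE i).

(** Conjunction of two values in {0, 1}. Both are always evaluated, so a loop test may read past its
    range; this is harmless since arrays are total. *)
Definition both (e1 e2 : expr) : expr := (#2 <= e1 + e2)%X.

Definition sum_weights : cmd :=
  rI ::= #0 ;; rS ::= #0 ;; For rI $0%X (rS ::= $rS + wE $rI).

Definition times (e : expr) : cmd :=
  rY ::= #0 ;; rJ ::= #0 ;; For rJ e (rY ::= $rY + $rX).

Definition double_pow : cmd :=
  aPow @ ($rD + #1) ::= Read aPow $rD + Read aPow $rD ;; rD ::= $rD + #1.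

(** In turn: the maximal arrival time; the least K with 2^K >= 2m; the least B, searched upwards
    from that maximum minus K; the least D >= K satisfying the root condition, whose left side is
    kept in [rY]; and the root task as the only entry of the queue. *)
Definition setup : cmd :=
  For rI $0%X (rA ::= $rA + (Read 0 $rI - $rA)) ;;
  aPow @ (#0) ::= #1 ;;
  While (Read aPow $rD + #1 <= $0 + $0)%X double_pow ;;
  rB ::= $rA - $rD ;;
  sum_weights ;;
  While ($0 + $0 <= $rS)%X (rB ::= $rB + #1 ;; sum_weights) ;;
  rX ::= $rS - wE #0 - wE ($0 - #1) ;;
  times $rD%X ;;
  rY ::= $rY + wE #0 + wE ($0 - #1) + wE ($0 - #1) ;;
  While (Read aPow $rD + wE #1 + #1 <= $rY)%X (double_pow ;; rY ::= $rY + $rX) ;;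
  aSl @ (#0) ::= #1 ;;
  aLo @ (#0) ::= #1 ;;
  aHi @ (#0) ::= $0 ;;
  aBud @ (#0) ::= $rD ;;
  rHp ::= #1 ;;
  1 ::= #1 ;;
  2 ::= $0.

Definition push (dst : nat) : cmd :=
  If (both ($nSl == #1) ($nHi <= $nLo))
    (dst @ ($rK) ::= Read aHeap $nSp)
    (dst @ ($rK) ::= $0 + $1 ;;
     1 @ ($1) ::= $nC ;;
     aSp @ ($1) ::= $nSp ;;
     aSl @ ($1) ::= $nSl ;;
     aLo @ ($1) ::= $nLo ;;
     aHi @ ($1) ::= $nHi ;;
     aBud @ ($1) ::= $rd ;;
     1 ::= $1 + #1).

Definition load : cmd :=
  rC ::= Read 1 $rK ;;
  rSp ::= Read aSp $rK ;;
  rSl ::= Read aSl $rK ;;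
  rLo ::= Read aLo $rK ;;
  rHi ::= Read aHi $rK ;;
  rd ::= Read aBud $rK - #1.

Definition scan_prefix : cmd :=
  rJ ::= #0 ;; rAcc ::= #0 ;;
  While (both ($rJ + #1 <= $rSl - ($rHi <= $rLo))
              ($rAcc + wE (Read aHeap ($rSp + $rJ)) <= Read aPow $rd))
    (rAcc ::= $rAcc + wE (Read aHeap ($rSp + $rJ)) ;; rJ ::= $rJ + #1).

(** The test is the condition of the left factor for [cut + 2], whose last alternating input is
    [cut + 1]. Accordingly [rX] sums the weights up to [cut], and [rY] is d times this sum. Steps of
    two preserve the parity. *)
Definition scan_cut : cmd :=
  rCut ::= $rLo ;; rX ::= wE $rLo ;; times $rd%X ;;
  While (both ($rCut + #3 <= $rHi)
              ($rAcc + $rY + (wE ($rCut + #1) + wE ($rCut + #1))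
               <= Read aPow $rd + wE $rLo))
    (rX ::= $rX + wE ($rCut + #1) + wE ($rCut + #2) ;;
     rCut ::= $rCut + #2 ;; times $rd%X).

Definition bucket : cmd :=
  rI ::= $rLo ;; rP ::= #0 ;;
  For rI ($rCut + #1)%X
    (If (both ($rP == #0) (bE $rI == $rd - $rE))
        (aHeap @ ($rQ) ::= $rI ;; rQ ::= $rQ + #1) Skip ;;
     rP ::= #1 - $rP).

(** One pass for each exponent d, d-1, ..., 0 produces decreasing weights. Larger exponents do not
    occur, by [fits_alt_wsum]. *)
Definition sort_evens : cmd :=
  rQ ::= $rHp ;; rE ::= #0 ;; For rE ($rd + #1)%X bucket.

(* Gate k is task k, so both children can be written as references at once: a
   child that is a single input needs no gate, any other child gets the next one. *)
Definition emit (second : cmd) : cmd :=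
  push 2 ;; second ;; push 3 ;; rK ::= $rK + #1.

Definition split_prefix : cmd :=
  nC ::= $rC ;; nSp ::= $rSp ;; nSl ::= $rJ ;; nLo ::= #0 ;; nHi ::= #0 ;;
  emit (nSp ::= $rSp + $rJ ;; nSl ::= $rSl - $rJ ;; nLo ::= $rLo ;; nHi ::= $rHi).

Definition split_cut : cmd :=
  nC ::= $rC ;; nSp ::= $rSp ;; nSl ::= $rSl ;; nLo ::= $rLo ;; nHi ::= $rCut ;;
  emit (nC ::= #1 - $rC ;; nSp ::= $rHp ;; nSl ::= $rQ - $rHp ;;
        nLo ::= $rCut + #1 ;; nHi ::= $rHi ;; rHp ::= $rQ).

Definition process : cmd :=
  load ;; scan_prefix ;;
  If (($rHi <= $rLo) + ($rJ + #1 <= $rSl))%X split_prefix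
     (scan_cut ;; sort_evens ;; split_cut).

Definition program : cmd := setup ;; While ($rK + #1 <= $1)%X process.

Ltac run :=
  repeat (cbv beta; lazymatch goal with
    | |- wp (Seq _ _) _ _ => apply: wp_seq
    | |- wp (Assign _ _) _ _ => apply: wp_assign
    | |- wp (Write _ _ _) _ _ => apply: wp_write
    end); rewrite /=.

Ltac same_state :=
  apply: state_ext => [r|x i] //=; repeat (case: eqP => [?|?]; subst => //=).

Lemma times_wp s e n : eval s e = n ->
  (forall j y, eval (set_reg (set_reg s rJ j) rY y) e = n) -> cost e = 1 ->
  wp (times e) s (fun s' k =>
    s' = set_reg (set_reg s rJ n) rY (n * regs s rX) /\ k <= 20 * n + 20).
Proof.
move=> en ee ce; rewrite /times; run.
apply: wp_conseq (wp_for (n := n) (T := 5) (i := 0) (I := fun j s' =>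
  s' = set_reg (set_reg s rJ j) rY (j * regs s rX)) _ _ _ _) _ => //.
- by move=> j _ _ ->; split=> //; apply: ee.
- move=> j _ _ ->; run; split=> //.
  by rewrite addn1 mulSn addnC; same_state.
- by rewrite mul0n; same_state.
by move=> s' k [-> le_k]; split=> //; move: le_k; rewrite ce; lia.
Qed.

Lemma sqr_le_exp n : 4 <= n -> n ^ 2 <= 2 ^ n.
Proof.
elim: n => // n IH; rewrite leq_eqVlt => /orP[/eqP <- //|/[!ltnS] le_n].
by move: (IH le_n); rewrite [2 ^ n.+1]expnS -!mulnn; move: (2 ^ n) => x; nia.
Qed.

(** * The setup phase: choice of the scaling B and the root budget D *)

Section Setup.

Variables (m : nat) (a : nat -> nat).
Hypothesis m_ge3 : 3 <= m.

Definition wtotal (B : nat) : nat := \sum_(0 <= i < m) 2 ^ (a i - B).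

Record pre (K : nat) (s : state) : Prop := Pre {
  pre_m : regs s 0 = m;
  pre_k : regs s rK = 0;
  pre_D : regs s rD = K;
  pre_arr : forall x i, arrs s x i = if x == 0 then a i else
                          if x == aPow then if i <= K then 2 ^ i else 0 else 0
}.

Lemma pre_weight K s B i : pre K s -> regs s rB = B -> a i - B <= K ->
  arrs s aPow (arrs s 0 i - regs s rB) = 2 ^ (a i - B).
Proof. by case=> _ _ _ ar -> le_K; rewrite !ar /= le_K. Qed.

Lemma double_pow_wp K s : pre K s ->
  wp double_pow s (fun s' k => [/\ pre K.+1 s',
    forall r, r != rD -> regs s' r = regs s r & k <= 20]).
Proof.
case=> em ek eD ar; rewrite /double_pow; run; split=> //; last first.
  by move=> r /negbTE ->.
split=> //=; first by rewrite eD addn1.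
move=> x i; rewrite !ar eD /= leqnn addn1.
case: eqP => [->|_] //=; case: eqP => [->|ne] //=.
  by rewrite leqnn expnS mul2n addnn.
by rewrite [i <= K.+1]leq_eqVlt ltnS; case: eqP.
Qed.

Lemma sum_weights_wp s B K : pre K s -> regs s rB = B ->
  (forall i, i < m -> a i - B <= K) ->
  wp sum_weights s (fun s' k =>
    s' = set_reg (set_reg s rI m) rS (wtotal B) /\ k <= 30 * m + 20).
Proof.
move=> pr eB le_K; rewrite /sum_weights; run.
apply: wp_conseq (wp_for (n := m) (T := 9) (i := 0) (I := fun j s' =>
  s' = set_reg (set_reg s rI j) rS (\sum_(0 <= i < j) 2 ^ (a i - B))) _ _ _ _) _ => //.
- by move=> j _ _ ->; split=> //; case: pr.
- move=> j s1 lt_j ->; run; split=> //.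
  rewrite (pre_weight pr eB) ?le_K // big_nat_recr //= addn1.
  by same_state.
- by rewrite big_geq //; same_state.
by move=> s' k [-> le_k]; split=> //; move: le_k => /=; lia.
Qed.

Definition amax : nat := \max_(i < m) a i.

Lemma wtotal_amax B : amax <= B -> wtotal B = m.
Proof.
move=> le_B; rewrite /wtotal big_mkord (eq_bigr (fun=> 1)) ?sum1_card ?card_ord //.
move=> i _; have : a i <= amax by rewrite /amax (leq_bigmax (F := fun i : 'I_m => a i)).
by move=> le_a; rewrite (_ : a i - B = 0) //; lia.
Qed.

(** A heaviest input alone weighs more than 2^K. Once 2^K >= 2m, no B below [amax - K] is therefore
    admissible, and the search for B may start at [amax - K]. *)
Lemma wtotal_gt B K : B + K < amax -> 2 ^ K < wtotal B.
Proof.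
have m0 : 0 < #|'I_m| by rewrite card_ord; lia.
have [i0 ei] := eq_bigmax (fun i : 'I_m => a i) m0.
move=> lt_B; rewrite /wtotal big_mkord (bigD1 i0) //=.
rewrite (leq_trans _ (leq_addr _ _)) // ltn_exp2l //.
by move: lt_B; rewrite /amax ei; lia.
Qed.

Lemma wtotal_ge B : m <= wtotal B.
Proof.
rewrite /wtotal big_mkord -[leqLHS]card_ord -sum1_card; apply: leq_sum => i _.
by rewrite expn_gt0.
Qed.

Definition weight_mid (B : nat) : nat := \sum_(1 <= i < m.-1) 2 ^ (a i - B).

(** The left side of the condition [fits] for the root task, with symmetric input 0 and alternating
    inputs 1, ..., m-1. *)
Definition root_load (B D : nat) : nat :=
  D * weight_mid B + 2 ^ (a 0 - B) + 2 * 2 ^ (a m.-1 - B).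

Lemma wtotalE B : wtotal B = 2 ^ (a 0 - B) + weight_mid B + 2 ^ (a m.-1 - B).
Proof.
rewrite /wtotal /weight_mid big_ltn; last by lia.
by rewrite -[in LHS](prednK (n := m)) ?big_nat_recr /= ?addnA //; lia.
Qed.

Lemma root_load_le B D : 1 < D -> root_load B D <= D * wtotal B.
Proof.
by rewrite wtotalE /root_load !mulnDr; move: (2 ^ _) (2 ^ _) => x y; nia.
Qed.

(** The minimality clauses for K, B and D are what later bounds 2^B and 2^(D-1) from above. *)
Record scaling (B K D : nat) : Prop := Scaling {
  scale_K : 2 * m <= 2 ^ K;
  scale_Kmin : 2 ^ K.-1 < 2 * m;
  scale_small : wtotal B < 2 * m;
  scale_Bmin : B = 0 \/ 2 * m <= wtotal B.-1;
  scale_max : forall i, i < m -> a i - B <= K;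
  scale_KD : K <= D;
  scale_root : root_load B D <= 2 ^ D + 2 ^ (a 1 - B);
  scale_Dmin : D = K \/ 2 ^ D.-1 + 2 ^ (a 1 - B) < root_load B D.-1
}.

Lemma scale_K3 K : 2 * m <= 2 ^ K -> 3 <= K.
Proof.
move=> geK; rewrite leqNgt; apply/negP => /ltnSE le2.
by have := leq_pexp2l (isT : 0 < 2) le2; rewrite -[2 ^ 2]/4; lia.
Qed.

(** A failing D satisfies 2^D < 2mD, which contradicts D^2 <= 2^D as soon as D >= 2m. This bounds
    the number of iterations in the search for D. *)
Lemma root_fail_lt B D : wtotal B < 2 * m -> 3 <= D ->
  2 ^ D + 2 ^ (a 1 - B) < root_load B D -> D < 2 * m.
Proof.
move=> small D3 fail; have := root_load_le B (ltnW D3).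
rewrite ltnNge; move=> le_r; apply/negP => ge_D.
have := sqr_le_exp (_ : 4 <= D); rewrite -mulnn => /(_ ltac:(lia)).
move: small fail le_r; move: (2 ^ D) (root_load _ _) (wtotal _) => x y z; nia.
Qed.

Definition slice (s : state) (p : nat) (l : seq nat) : Prop :=
  forall i, i < size l -> arrs s aHeap (p + i) = nth 0 l i.

(** Array 1 stores 0 for And, as the output format demands. The field [stored_hp] keeps the slice
    below the heap pointer, so that slices written later do not disturb it. *)
Record stored (s : state) (j : nat) (t : task) : Prop := Stored {
  stored_and : arrs s 1 j = ~~ tand t;
  stored_size : arrs s aSl j = size (tsym t);
  stored_lo : arrs s aLo j = tlo t;
  stored_hi : arrs s aHi j = thi t;
  stored_bud : arrs s aBud j = tbud t;
  stored_slice : slice s (arrs s aSp j) (tsym t);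
  stored_hp : arrs s aSp j + size (tsym t) <= regs s rHp
}.

Definition dummy : task := Task true [::] 0 0 0.

Record memory (B D : nat) (s : state) (q : seq task) : Prop := Mem {
  mem_m : regs s 0 = m;
  mem_B : regs s rB = B;
  mem_root : regs s 2 = m;
  mem_in : forall i, arrs s 0 i = a i;
  mem_pow : forall e, e <= D -> arrs s aPow e = 2 ^ e;
  mem_cnt : regs s 1 = size q;
  mem_task : forall j, j < size q -> stored s j (nth dummy q j)
}.

Definition root_task (D : nat) : task := Task true [:: 0] 1 m D.

Lemma pow_loop_wp s : pre 0 s ->
  wp (While (Read aPow $rD + #1 <= $0 + $0)%X double_pow) s (fun s' k =>
    exists K, [/\ pre K s', regs s' rA = regs s rA, 2 * m <= 2 ^ K, 2 ^ K.-1 < 2 * m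
      & k <= 60 * m + 20]).
Proof.
move=> pr; apply: wp_conseq (wp_while (v := (2 * m - 0) * 30) (I := fun v s' =>
  exists K, [/\ pre K s', regs s' rA = regs s rA, 2 ^ K.-1 < 2 * m
    & v = (2 * m - K) * 30]) _ _) _.
- move=> v s1 [K [pr1 eA le_K ->]]; rewrite /= !(pre_m pr1) (pre_D pr1) (pre_arr pr1) /= leqnn.
  rewrite eqb0 negbK addn1 addnn -mul2n => lt_K.
  apply: wp_conseq (double_pow_wp pr1) _ => s2 k [pr2 fr le_k].
  exists ((2 * m - K.+1) * 30); split; first by exists K.+1; split=> //; rewrite fr.
  (* The test gave 2^K < 2m, and K < 2^K; hence the potential strictly decreases. *)
  by have := ltn_expl K (isT : 1 < 2); lia.
- by exists 0; split=> //; rewrite expn0; lia.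
move=> s' k [v [[K [pr1 eA le_K ->]]]].
rewrite /= !(pre_m pr1) (pre_D pr1) (pre_arr pr1) /= leqnn.
move=> /eqP; rewrite eqb0 -ltnNge addn1 addnn -mul2n ltnS => ge_K le_k.
by exists K; split=> //; lia.
Qed.

(** At B = [amax] all weights are 1 and the total is m < 2m, so at most K increments are made. *)
Lemma scale_loop_wp s K B : pre K s -> regs s rB = B -> regs s rS = wtotal B ->
  B = amax - K -> 2 * m <= 2 ^ K ->
  wp (While ($0 + $0 <= $rS)%X (rB ::= $rB + #1 ;; sum_weights)) s (fun s' k =>
    exists B', [/\ pre K s', regs s' rB = B' /\ regs s' rS = wtotal B',
      wtotal B' < 2 * m /\ (B' = 0 \/ 2 * m <= wtotal B'.-1), amax - B' <= K
      & k <= K * (30 * m + 50) + 20]).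
Proof.
move=> pr eB eS dB geK.
apply: wp_conseq (wp_while (v := (amax - B) * (30 * m + 50)) (I := fun v s' =>
  exists B', [/\ pre K s', regs s' rB = B', regs s' rS = wtotal B',
      B' = 0 \/ 2 * m <= wtotal B'.-1 & amax - B' <= K /\ v = (amax - B') * (30 * m + 50)]) _ _) _.
- move=> v s1 [B1 [pr1 eB1 eS1 min1 [le1 ->]]].
  rewrite /= !(pre_m pr1) eS1 eqb0 negbK addnn -mul2n => big.
  have lt_B1 : B1 < amax.
    by rewrite ltnNge; apply/negP => /wtotal_amax; lia.
  apply: wp_seq; apply: wp_assign.
  have pr2 : pre K (set_reg s1 rB (B1 + 1)) by case: pr1 => *; split.
  rewrite /= eB1; apply: wp_conseq (sum_weights_wp (B := B1 + 1) pr2 _ _) _ => //.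
    move=> i lt_i; have : a i <= amax.
      by rewrite /amax (leq_bigmax (F := fun i : 'I_m => a i) (Ordinal lt_i)).
    by lia.
  move=> s2 k [-> le_k]; exists ((amax - B1.+1) * (30 * m + 50)); split; last first.
    by rewrite (_ : amax - B1 = (amax - B1.+1).+1) ?mulSn; lia.
  exists (B1 + 1); split=> //; first by case: pr2 => *; split.
    by right; rewrite addn1.
  by rewrite addn1; lia.
- exists B; split=> //; last by lia.
  case: (posnP B) => [|B0]; first by left.
  by right; have := @wtotal_gt B.-1 K; lia.
move=> s' k [v [[B1 [pr1 eB1 eS1 min1 [le1 ->]]]]].
rewrite /= !(pre_m pr1) eS1 => /eqP; rewrite eqb0 -ltnNge addnn -mul2n => small le_k.
exists B1; split=> //.
have : (amax - B) * (30 * m + 50) <= K * (30 * m + 50) by rewrite leq_mul2r; lia.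
by move: le_k; move: (_ * _) (_ * _) (_ * _) => x y z; lia.
Qed.

Lemma root_loop_wp s K B : pre K s -> regs s rB = B -> regs s rX = weight_mid B ->
  regs s rY = root_load B K -> wtotal B < 2 * m -> 3 <= K ->
  (forall i, i < m -> a i - B <= K) ->
  wp (While (Read aPow $rD + wE #1 + #1 <= $rY)%X (double_pow ;; rY ::= $rY + $rX)) s
   (fun s' k => exists D, [/\ pre D s', regs s' rB = B, K <= D /\
      root_load B D <= 2 ^ D + 2 ^ (a 1 - B),
      D = K \/ 2 ^ D.-1 + 2 ^ (a 1 - B) < root_load B D.-1
      & k <= 120 * m + 20]).
Proof.
move=> pr eB eX eY small K3 le_max.
have le_1 : a 1 - B <= K by apply: le_max; lia.
apply: wp_conseq (wp_while (v := (2 * m - K) * 60) (I := fun v s' =>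
  exists D, [/\ pre D s', regs s' rB = B /\ regs s' rX = weight_mid B,
     regs s' rY = root_load B D, K <= D /\
     (D = K \/ 2 ^ D.-1 + 2 ^ (a 1 - B) < root_load B D.-1)
     & v = (2 * m - D) * 60]) _ _) _.
- move=> v s1 [D [pr1 [eB1 eX1] eY1 [leD minD] ->]].
  rewrite [eval _ _]/= eY1 (pre_weight pr1 eB1) ?(leq_trans le_1) //.
  rewrite (pre_D pr1) (pre_arr pr1) /= leqnn eqb0 negbK addn1 => lt_D.
  have D2m := root_fail_lt small (leq_trans K3 leD) lt_D.
  apply: wp_seq; apply: wp_conseq (double_pow_wp pr1) _ => s2 k [pr2 fr le_k].
  apply: wp_assign; exists ((2 * m - D.+1) * 60); split; last by rewrite /=; lia.
  exists D.+1; split=> //=.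
  + by case: pr2 => *; split.
  + by rewrite !fr.
  + by rewrite !fr // eY1 eX1 /root_load mulSn; lia.
  + by split; [apply: leqW | right].
- by exists K; split=> //; split=> //; left.
move=> s' k [v [[D [pr1 [eB1 eX1] eY1 [leD minD] ->]]]].
rewrite [eval _ _]/= eY1 (pre_weight pr1 eB1) ?(leq_trans le_1) //.
rewrite (pre_D pr1) (pre_arr pr1) /= leqnn => /eqP; rewrite eqb0 -ltnNge addn1 ltnS.
by move=> ge_D le_k; exists D; split=> //; lia.
Qed.

Lemma setup_wp s : (forall r, regs s r = if r == 0 then m else 0) ->
  (forall x i, arrs s x i = if x == 0 then a i else 0) ->
  wp setup s (fun s' k => exists B K D, [/\ scaling B K D,
    memory B D s' [:: root_task D], regs s' rK = 0 & k <= 300 * (m * D)]).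
Proof.
move=> es ea; rewrite /setup; apply: wp_seq.
apply: wp_conseq (wp_for (n := m) (T := 9) (i := 0) (I := fun j s' =>
  s' = set_reg (set_reg s rI j) rA (\max_(0 <= i < j) a i)) _ _ _ _) _ => //.
- by move=> j _ _ -> /=; rewrite es.
- move=> j s1 lt_j ->; run; split=> //.
  by rewrite big_nat_recr //= maxnE addn1 ea; same_state.
- by rewrite big_geq //; same_state; rewrite es.
move=> s1 k1 [-> le_k1]; apply: wp_seq; apply: wp_write.
set s2 := set_arr _ _ _ _.
have pr0 : pre 0 s2.
  split; rewrite /= ?es // => x i; rewrite ea leqn0.
  by case: eqP => [->|_] //=; case: eqP => [->|_] //=; case: eqP => [->|_].
apply: wp_seq; apply: wp_conseq (pow_loop_wp pr0) _ => s3 k3 [K [pr3 eA3 geK minK le_k3]].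
have {}eA3 : regs s3 rA = amax by rewrite eA3 /= big_mkord.
have K3 := scale_K3 geK.
apply: wp_seq; apply: wp_assign; rewrite /= (pre_D pr3) eA3.
set s4 := set_reg s3 _ _; have pr4 : pre K s4 by case: pr3 => *; split.
have le_amax i : i < m -> a i <= amax.
  by move=> lt_i; rewrite /amax (leq_bigmax (F := fun i : 'I_m => a i) (Ordinal lt_i)).
apply: wp_seq; apply: wp_conseq (sum_weights_wp (B := amax - K) pr4 _ _) _ => //.
  by move=> i /le_amax; lia.
move=> s5 k5 [-> le_k5].
apply: wp_seq; apply: wp_conseq (scale_loop_wp (K := K) (B := amax - K) _ _ _ _ _) _ => //.
  by case: pr4 => *; split.
move=> s6 k6 [B [pr6 [eB6 eS6] [small minB] leB le_k6]].
have le_max i : i < m -> a i - B <= K by move=> /le_amax; lia.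
have pw i : i < m -> arrs s6 aPow (a i - B) = 2 ^ (a i - B).
  by move=> lt_i; rewrite (pre_arr pr6) /= le_max.
have ar0 i : arrs s6 0 i = a i by rewrite (pre_arr pr6).
have m0 : 0 < m by lia.
have m1 : m - 1 < m by lia.
run; rewrite !eB6 !(pre_m pr6) !ar0 !pw // eS6.
set s7 := set_reg s6 _ _.
apply: wp_conseq (times_wp (n := K) _ _ _) _ => //; rewrite /= ?(pre_D pr6) //.
move=> s8 k8 [-> le_k8]; run; rewrite !eB6 !(pre_m pr6) !ar0 !pw //.
have emid : wtotal B - 2 ^ (a 0 - B) - 2 ^ (a (m - 1) - B) = weight_mid B.
  by rewrite wtotalE subn1; lia.
set s9 := set_reg _ _ _; have pr9 : pre K s9 by case: pr6 => *; split.
apply: wp_conseq (root_loop_wp (B := B) pr9 _ _ _ _ _ _) _ => //.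
  by rewrite /= emid /root_load subn1; lia.
move=> s10 k10 [D [pr10 eB10 [leKD rootD] minD le_k10]].
run; exists B, K, D; split=> //; last first.
- have le_Km : K * m <= m * D by rewrite mulnC leq_mul2l leKD orbT.
  have le_m : 3 * m <= m * D by rewrite mulnC leq_mul2l (leq_trans K3) ?orbT.
  have le_D : 3 * D <= m * D by rewrite leq_mul2r m_ge3 orbT.
  by move: leKD m_ge3 K3 le_Km le_m le_D le_k1 le_k3 le_k5 le_k6 le_k8 le_k10;
    rewrite /=; clear; lia.
- by rewrite (pre_k pr10).
case: pr10 => em ek eD ar; split=> //=; rewrite ?em //.
- by move=> e le_e; rewrite ar /= le_e.
(* The root task relies on the memory being zero initially: its slice starts at heap cell 0, that
   cell names input 0, and kind 0 means And. *)
case=> //= _; split=> //=; rewrite ?ar ?em ?eD //.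
by case=> //= _; rewrite ar.
Qed.

End Setup.

(** * The main loop over the queue of tasks *)

Section MainLoop.

Variables (m : nat) (a : nat -> nat) (B D : nat).
Local Notation b := (fun i => a i - B).
Local Notation memory := (memory m a B D).

Lemma mem_frame s s' q :
  (forall r, r \in [:: 0; 1; 2; rB; rHp] -> regs s' r = regs s r) ->
  (forall x i, x \notin [:: 2; 3] -> arrs s' x i = arrs s x i) ->
  memory s q -> memory s' q.
Proof.
move=> er ea [em eB e2 ein epow ecnt st].
split=> [||| i| e le_e| |j lt_j]; rewrite ?er ?ea //; first exact: epow.
case: (st j lt_j) => *; split; rewrite ?er ?ea // => i lt_i.
by rewrite ea //; auto.
Qed.

Lemma mem_wE s q i : memory s q -> b i <= D ->
  arrs s aPow (arrs s 0 i - regs s rB) = 2 ^ b i.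
Proof. by case=> _ -> _ ein epow _ _ le_i; rewrite ein epow. Qed.

Lemma leq2_bool (x y : bool) : (2 <= x + y) = x && y.
Proof. by case: x y => [] []. Qed.

Lemma scan_prefix_wp s q sy lo hi d : memory s q -> d <= D ->
  slice s (regs s rSp) sy -> regs s rSl = size sy -> regs s rLo = lo ->
  regs s rHi = hi -> regs s rd = d -> {in sy, forall i, b i <= D} ->
  wp scan_prefix s (fun s' k => exists j, let acc := wsum b (take j sy) in
    let lim := size sy - (hi <= lo) in
    [/\ s' = set_reg (set_reg s rJ j) rAcc acc, j <= lim, acc <= 2 ^ d,
        j = lim \/ 2 ^ d < acc + 2 ^ b (nth 0 sy j) & k <= 60 * size sy + 60]).
Proof.
move=> M le_d sl eSl eLo eHi ed small; rewrite /scan_prefix; run.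
set lim := size sy - (hi <= lo); have le_lim : lim <= size sy by rewrite leq_subr.
apply: wp_conseq (wp_while (v := lim * 60) (I := fun v s' =>
  exists j, [/\ s' = set_reg (set_reg s rJ j) rAcc (wsum b (take j sy)), j <= lim,
    wsum b (take j sy) <= 2 ^ d & v = (lim - j) * 60]) _ _) _.
- move=> v s1 [j [-> le_j le_w ->]].
  rewrite /= eSl eLo eHi ed leq2_bool eqb0 negbK -/lim addn1 (mem_pow M le_d) => /andP[lt_j].
  have lt_sy : j < size sy by lia.
  rewrite sl // (mem_wE M) ?small ?mem_nth // => le_w'.
  have tk : wsum b (take j.+1 sy) = wsum b (take j sy) + 2 ^ b (nth 0 sy j).
    by rewrite (take_nth 0) // -cats1 wsum_cat /wsum big_seq1.
  run; rewrite sl // (mem_wE M) ?small ?mem_nth //.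
  exists ((lim - j.+1) * 60); split; last by lia.
  exists j.+1; split=> //; last by rewrite tk.
  by rewrite addn1 tk; same_state.
- by exists 0; split=> //; rewrite ?take0 /wsum ?big_nil ?expn_gt0 ?subn0.
move=> s' k [v [[j [-> le_j le_w ->]]]].
rewrite /= eSl eLo eHi ed leq2_bool -/lim addn1 (mem_pow M le_d) => /eqP.
rewrite eqb0 negb_and -leqNgt -ltnNge => fail le_k.
exists j; split=> //; last by lia.
case: (leqP lim j) fail => [ge_j _|lt_j /=]; first by left; lia.
rewrite sl ?(leq_trans lt_j) // (mem_wE M); first by right.
by apply/small/mem_nth/(leq_trans lt_j).
Qed.

Lemma scan_cut_wp s q sy lo hi d : memory s q -> d <= D ->
  regs s rAcc = wsum b sy -> wsum b sy <= 2 ^ d -> 0 < size sy ->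
  regs s rLo = lo -> regs s rHi = hi -> regs s rd = d -> lo < hi <= m ->
  (forall i, i < m -> b i <= D) -> fits b d.+1 sy lo hi ->
  wp scan_cut s (fun s' k => exists cut, let X := \sum_(lo <= i < cut.+1) 2 ^ b i in
    [/\ s' = set_reg (set_reg (set_reg (set_reg s rCut cut) rX X) rJ d) rY (d * X),
      ~~ odd (cut - lo) /\ lo <= cut < hi, fits b d sy lo cut,
      hi <= cut.+2 \/ 2 ^ d + 2 ^ b lo < wsum b sy + d * X + 2 * 2 ^ b cut.+1
    & k <= m * (20 * d + 90) + 20 * d + 90]).
Proof.
move=> M le_d eAcc le_w s0 eLo eHi ed /andP[lt_lo le_hi] small ft.
have wm i : i < m -> arrs s aPow (arrs s 0 i - regs s rB) = 2 ^ b i.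
  by move=> lt_i; rewrite (mem_wE M) // small.
rewrite /scan_cut; run; rewrite eLo wm; last by apply: leq_trans le_hi.
apply: wp_conseq (times_wp (n := d) _ _ _) _ => //= s1 k1 [-> le_k1].
apply: wp_conseq (wp_while (v := (hi - lo) * (20 * d + 90)) (I := fun v s' =>
  exists cut, let X := \sum_(lo <= i < cut.+1) 2 ^ b i in
    [/\ s' = set_reg (set_reg (set_reg (set_reg s rCut cut) rX X) rJ d) rY (d * X),
      ~~ odd (cut - lo) /\ lo <= cut < hi, fits b d sy lo cut
    & v = (hi - cut) * (20 * d + 90)]) _ _) _.
- move=> v s2 [cut [-> [ev /andP[le_cut lt_cut]] fc ->]].
  rewrite [eval _ _]/= leq2_bool eHi eLo ed eAcc eqb0 negbK (mem_pow M le_d).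
  case/andP=> lt3; rewrite addn1 !wm; try lia.
  move=> fit; run; rewrite !wm; try lia.
  apply: wp_conseq (times_wp (n := d) _ _ _) _ => //= s3 k3 [-> le_k3].
  exists ((hi - cut.+2) * (20 * d + 90)); split; last first.
    by rewrite (_ : hi - cut = (hi - cut.+2).+2) ?mulSn; lia.
  have lt1 : lo.+1 < hi by move: lt3 le_cut; clear; lia.
  have dpos : 0 < d by have := fits_alt_bud lt1 s0 ft; clear; lia.
  have recr F : \sum_(lo <= i < cut.+3) F i =
      \sum_(lo <= i < cut.+1) F i + F cut.+1 + F cut.+2 :> nat.
    by rewrite big_nat_recr ?[\sum_(lo <= i < cut.+2) _]big_nat_recr //=; lia.
  exists cut.+2; split=> //.
  + by rewrite !addn2 addn1 recr; same_state.
  + by split; [rewrite -addn2 -addnBAC // oddD addbF | lia].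
  + rewrite /fits (_ : lo < cut.+2) ?dpos //=; last by lia.
    by move: fit; lia.
- exists lo; split=> //.
  + by rewrite big_nat1; same_state.
  + by rewrite subnn leqnn lt_lo.
  + by rewrite /fits ltnn.
move=> s' k [v [[cut [-> [ev /andP[le_cut lt_cut]] fc ->]]]].
rewrite [eval _ _]/= leq2_bool eHi eLo ed eAcc (mem_pow M le_d) => /eqP.
rewrite eqb0 negb_and -!ltnNge => fail le_k.
exists cut; split=> //; first by rewrite le_cut.
- case: (ltnP hi (cut + 3)) fail => [lt3 _|lt3 /=]; first by left; lia.
  by rewrite addn1 !wm; [right; lia|lia|lia].
- have : (hi - lo) * (20 * d + 90) <= m * (20 * d + 90) by rewrite leq_mul2r; lia.
  move: le_k le_k1 => /=; move: ((hi - cut) * _) ((hi - lo) * _) (m * _) => x y z.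
  by clear; lia.
Qed.

(** Frame condition of the sort: memory changes only in heap cells at or above the heap pointer, so
    all stored slices survive. *)
Definition sorting (s s' : state) : Prop :=
  (forall r, r \notin [:: rI; rE; rQ; rP] -> regs s' r = regs s r) /\
  (forall x i, (x != aHeap) || (i < regs s rHp) -> arrs s' x i = arrs s x i).

Definition holds (s : state) (p : nat) (l : seq nat) : Prop :=
  slice s p l /\ regs s rQ = p + size l.

Lemma sorting_set s s' r n : r \in [:: rI; rE; rQ; rP] ->
  sorting s s' -> sorting s (set_reg s' r n).
Proof.
move=> hr [fr fa]; split=> //= r' nr; rewrite fr //.
by case: eqP nr hr => // -> /negbTE->.
Qed.

Lemma bucket_wp s s1 q lo cut d e l : memory s q -> regs s rLo = lo ->
  regs s rCut = cut -> regs s rd = d -> lo <= cut ->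
  sorting s s1 -> regs s1 rE = e -> holds s1 (regs s rHp) l ->
  wp bucket s1 (fun s' k => [/\ sorting s s', regs s' rE = e,
    holds s' (regs s rHp) (l ++ [seq i <- evens lo cut | b i == d - e])
    & k <= (cut.+1 - lo) * 60 + 60]).
Proof.
move=> M eLo eCut ed le_cut [fr fa] eE [sl eQ]; rewrite /bucket; run.
rewrite fr // eLo.
apply: wp_conseq (wp_for (n := cut.+1) (T := 40) (i := lo) (I := fun i s' =>
  [/\ sorting s s' /\ regs s' rE = e, lo <= i /\ regs s' rI = i, regs s' rP = odd (i - lo)
    & holds s' (regs s rHp) (l ++ [seq j <- [seq j <- index_iota lo i | ~~ odd (j - lo)]
                                      | b j == d - e])]) _ _ _ _) _ => //.
- by move=> i s2 _ [[[fr2 _] _] [_ ->] _ _] /=; rewrite fr2 // eCut addn1.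
- move=> i s2 lt_i [[[fr2 fa2] eE2] [ge_lo eI] eP [sl2 eQ2]].
  have io : index_iota lo i.+1 = rcons (index_iota lo i) i.
    by rewrite /index_iota subSn // -addn1 iotaD subnKC // cats1.
  have par : 1 - odd (i - lo) = odd (i + 1 - lo) by rewrite addn1 (subSn ge_lo) /=; case: (odd _).
  apply: wp_seq; apply: wp_if => /=;
    rewrite leq2_bool (fr2 rd) // ed eE2 eI eP fa2 // (mem_in M) (fr2 rB) // (mem_B M) eqb0.
    rewrite negbK => /andP[ev be].
    have app : [seq j <- [seq j <- index_iota lo i.+1 | ~~ odd (j - lo)] | b j == d - e] =
        rcons [seq j <- [seq j <- index_iota lo i | ~~ odd (j - lo)] | b j == d - e] i.
      by rewrite io filter_rcons -eqb0 ev filter_rcons be.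
    run; split=> //; split=> //=.
    + split=> //; split=> [r|x j] /=.
        by rewrite !inE => nr; rewrite !ifN ?fr2 ?inE; lia.
      move=> xj; rewrite ifN ?fa2 //; apply: contraL xj => /andP[/eqP-> /eqP->].
      by rewrite eQ2 -leqNgt leq_addr.
    + by rewrite eI addn1; split=> //; apply: leqW.
    + by rewrite eP par addn1.
    + rewrite app -rcons_cat; split=> /=; last by rewrite eQ2 size_rcons; lia.
      move=> j /=; rewrite size_rcons ltnS leq_eqVlt nth_rcons eQ2 eqn_add2l => /orP[/eqP->|lt_j].
        by rewrite ltnn eqxx.
      by rewrite lt_j ltn_eqF //; apply: sl2.
  move=> /eqP; rewrite eqb0 => skip.
  have app : [seq j <- [seq j <- index_iota lo i.+1 | ~~ odd (j - lo)] | b j == d - e] =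
      [seq j <- [seq j <- index_iota lo i | ~~ odd (j - lo)] | b j == d - e].
    rewrite io filter_rcons; case: ifP => // ev; rewrite filter_rcons.
    by move: skip; rewrite ev /= => /negbTE ->.
  apply: wp_skip; run; split=> //; split=> //=.
    + split=> //; split=> [r|x j] /=; last by move=> ?; rewrite fa2.
      by rewrite !inE => nr; rewrite !ifN ?fr2 ?inE; lia.
    + by rewrite eI addn1; split=> //; apply: leqW.
    + by rewrite eP par addn1.
    + by rewrite app.
- exact: leqW.
- have lo0 : index_iota lo lo = [::] by rewrite /index_iota subnn.
  split; rewrite ?lo0 ?subnn ?cats0 //=; split=> //=.
  by do 2!apply: sorting_set => //.
move=> s' k [[[so eE'] _ _ hl] le_k]; split=> //.
by move: le_k => /=; clear; lia.
Qed.

Lemma sort_evens_wp s q lo cut d : memory s q -> regs s rLo = lo ->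
  regs s rCut = cut -> regs s rd = d -> lo <= cut < m ->
  wp sort_evens s (fun s' k => [/\ sorting s s',
    holds s' (regs s rHp) (bsort b d.+1 (evens lo cut))
    & k <= (d + 1) * (m * 60 + 90) + 90]).
Proof.
move=> M eLo eCut ed /andP[le_cut lt_m].
(* [L] is kept opaque. The loop invariant says that the buckets collected so far, followed by those
   still to come, form [L]. *)
have [L eL] : exists L, bsort b d.+1 (evens lo cut) = L by eexists.
rewrite eL /sort_evens; run.
apply: wp_conseq (wp_for (n := d.+1) (T := m * 60 + 60) (i := 0) (I := fun j s' =>
  exists l, [/\ sorting s s', regs s' rE = j, holds s' (regs s rHp) l &
    l ++ bsort b (d.+1 - j) (evens lo cut) = L]) _ _ _ _) _ => //.
- by move=> j s1 _ [l [[fr _] -> _ _]] /=; rewrite fr // ed addn1.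
- move=> j s1 lt_j [l [so eE hl el]].
  apply: wp_conseq (bucket_wp M eLo eCut ed le_cut so eE hl) _ => s2 k [so2 eE2 hl2 le_k].
  split; last first.
    by rewrite (leq_trans le_k) // leq_add2r leq_mul2r; lia.
  exists (l ++ [seq i <- evens lo cut | b i == d - j]); split=> //.
  + exact: sorting_set.
  + by rewrite /= eE2 addn1.
  + by rewrite -el -catA; congr cat; rewrite subSS subSn.
- exists [::]; rewrite subn0; split=> //; last by split=> //=; rewrite addn0.
  by do 2!apply: sorting_set => //.
move=> s' k [[l [so _ hl]]]; rewrite subnn cats0 => <- le_k; split=> //.
by move: le_k => /=; rewrite !mulnDr; clear; lia.
Qed.

Definition child_ref (q : seq task) (t : task) : nat :=
  if leaf t then head 0 (tsym t) else m + size q.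

Definition enqueue (q : seq task) (t : task) : seq task :=
  if leaf t then q else rcons q t.

Lemma push_wp dst s q t : dst \in [:: 2; 3] -> memory s q ->
  regs s nC = ~~ tand t -> regs s nSl = size (tsym t) -> regs s nLo = tlo t ->
  regs s nHi = thi t -> regs s rd = tbud t -> slice s (regs s nSp) (tsym t) ->
  regs s nSp + size (tsym t) <= regs s rHp -> 0 < size (tsym t) ->
  wp (push dst) s (fun s' k =>
    [/\ memory s' (enqueue q t), forall r, r != 1 -> regs s' r = regs s r,
      arrs s' dst (regs s rK) = child_ref q t,
      forall x i, x \in [:: 2; 3; aHeap] -> (x != dst) || (i != regs s rK) ->
         arrs s' x i = arrs s x i & k <= 80]).
Proof.
move=> hdst M eC eSl eLo eHi ed sl hp s0.
have d23 : dst = 2 \/ dst = 3 by move: hdst; rewrite !inE => /orP[] /eqP; auto.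
have d5 : dst != 5 by apply: contraTneq hdst => ->.
rewrite /push; apply: wp_if; rewrite [eval _ _]/= leq2_bool eSl eHi eLo -/(leaf t).
  rewrite eqb0 negbK => lf; apply: wp_write; rewrite /child_ref /enqueue lf.
  split=> //=.
  - apply: mem_frame M => // x i nx /=; rewrite ifN //; apply: contraNN nx => /andP[/eqP-> _] //.
  - by rewrite !eqxx -nth0 -(sl 0 s0) addn0.
  - by move=> x i _; rewrite -negb_and => /negbTE->.
move=> /eqP; rewrite eqb0 => /negbTE nlf; rewrite /child_ref /enqueue nlf; run.
have [em eB e2 ein epow ecnt st] := M.
have nd x : x \notin [:: 2; 3] -> (x == dst) = false by move=> nx; apply: contraNF nx => /eqP->.
split=> //=; first last.
- move=> x i; rewrite !inE => /or3P[] /eqP->; rewrite -negb_and => /negbTE -> //.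
- by rewrite !eqxx em ecnt; case: d23 => ->.
- by move=> r /negbTE->.
split=> //=; rewrite ?nd //.
- by rewrite size_rcons ecnt addn1.
move=> j; rewrite size_rcons ltnS leq_eqVlt => /orP[/eqP->|lt_j].
  rewrite nth_rcons ltnn eqxx.
  split; rewrite /= ?nd //= ?ecnt ?eqxx ?eSl ?eLo ?eHi ?ed //.
  by move=> i lt_i /=; rewrite nd //=; apply: sl.
rewrite nth_rcons lt_j; case: (st j lt_j) => *.
split; rewrite /= ?nd //= ?ecnt ?(ltn_eqF lt_j) // => i lt_i /=.
by rewrite nd //=; auto.
Qed.

(** The potential of a task: O(m) for every gate still to be built for it, and O(mD) for every
    alternating element, since an alternating split loses at least one such element. *)
Definition cost_of (t : task) : nat :=
  200 * m * (leaves t).-1 + 400 * (m * D.+1) * (thi t - tlo t).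

(** The loop invariant after [k] tasks. What has been produced plus what the pending tasks may still
    cause stays within the bounds of the root task: [pg_input] yields the fanout, [pg_size] the
    number of gates, [pg_cost] the time. By [pg_touch] no input ends up without successor. *)
Record progress (k v : nat) (s : state) (q : seq task) : Prop := Progress {
  pg_mem : memory s q;
  pg_k : regs s rK = k;
  pg_le : k <= size q;
  pg_root : nth dummy q 0 = root_task m D;
  pg_ok : forall j, j < size q ->
    [/\ valid m b (nth dummy q j), ~~ leaf (nth dummy q j) & tbud (nth dummy q j) <= D];
  pg_child : forall j, j < k -> exists t1 t2,
    [/\ refines m b (nth dummy q j) t1 t2,
        linked m (nth dummy q) (size q) j (arrs s 2 j) t1 &
        linked m (nth dummy q) (size q) j (arrs s 3 j) t2];
  pg_gate : forall j, refs s k (m + j) = (0 < j < size q);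
  pg_input : forall i, i < m ->
    refs s k i + \sum_(t <- drop k q) copies t i <= copies (root_task m D) i;
  pg_touch : forall i, i < m -> 0 < refs s k i \/ has (fun t => touches t i) (drop k q);
  pg_size : k + \sum_(t <- drop k q) (leaves t).-1 <= (leaves (root_task m D)).-1;
  pg_cost : \sum_(t <- drop k q) cost_of t <= v
}.

Lemma leaves_gt0 t : valid m b t -> 0 < leaves t.
Proof. by case=> s0 _ _ _ _; rewrite /leaves addn_gt0 s0. Qed.

Lemma leaf_leaves t : leaf t -> leaves t = 1 /\ thi t - tlo t = 0.
Proof.
by rewrite /leaf /leaves -subn_eq0 => /andP[/eqP-> /eqP->].
Qed.

Lemma sum_enqueue k q t (f : task -> nat) : k <= size q ->
  \sum_(u <- drop k (enqueue q t)) f u =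
  \sum_(u <- drop k q) f u + (if leaf t then 0 else f t).
Proof.
move=> le_k; rewrite /enqueue; case: ifP => // _; first by rewrite addn0.
rewrite -cats1 drop_cat; case: ltnP => lt_k; first by rewrite big_cat big_seq1.
by rewrite (_ : k = size q) ?subnn ?drop0 ?drop_size ?big_nil ?big_seq1 //; lia.
Qed.

Lemma has_enqueue k q t (p : pred task) : k <= size q ->
  has p (drop k (enqueue q t)) = has p (drop k q) || (~~ leaf t && p t).
Proof.
move=> le_k; rewrite /enqueue; case: ifP => // _; first by rewrite orbF.
rewrite -cats1 drop_cat; case: ltnP => lt_k; first by rewrite has_cat has_seq1.
by rewrite (_ : k = size q) ?subnn ?drop0 ?drop_size ?has_seq1 //; lia.
Qed.

Lemma size_enqueue q t : size (enqueue q t) = size q + ~~ leaf t.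
Proof. by rewrite /enqueue; case: ifP; rewrite ?size_rcons ?addn0 ?addn1. Qed.

Lemma nth_enqueue q t j : j < size q -> nth dummy (enqueue q t) j = nth dummy q j.
Proof. by rewrite /enqueue; case: ifP => // _ lt_j; rewrite nth_rcons lt_j. Qed.

(** The two conclusions treat [t] as first and as second child. New tasks are appended to the queue,
    so their numbers exceed [k]. *)
Lemma linked_child q t t' k : k < size q ->
  linked m (nth dummy (enqueue (enqueue q t) t')) (size (enqueue (enqueue q t) t')) k
    (child_ref q t) t /\
  linked m (nth dummy (enqueue (enqueue q t') t)) (size (enqueue (enqueue q t') t)) k
    (child_ref (enqueue q t') t) t.
Proof.
move=> lt_k; rewrite /linked /child_ref; case: ifP => lf; first by split; left.
split; right.
  exists (size q); rewrite nth_enqueue !size_enqueue lf; last by lia.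
  by split=> //; rewrite ?lt_k /=; [lia | rewrite /enqueue lf nth_rcons ltnn eqxx].
exists (size (enqueue q t')); split=> //.
  by rewrite [size (enqueue (enqueue _ _) _)]size_enqueue lf size_enqueue; lia.
by rewrite [enqueue (enqueue q t') t]/enqueue lf nth_rcons ltnn eqxx.
Qed.

Lemma linked_mono q t j n k r u : linked m (nth dummy q) n k r u -> n = size q ->
  j = size (enqueue q t) -> linked m (nth dummy (enqueue q t)) j k r u.
Proof.
move=> + en ->; rewrite {}en => -[h|[i [er lt_i ei]]]; [by left | right]; exists i; split=> //.
  by rewrite size_enqueue; lia.
by rewrite nth_enqueue //; lia.
Qed.

Lemma refsS s s' k r : (forall j, j < k -> arrs s' 2 j = arrs s 2 j /\ arrs s' 3 j = arrs s 3 j) ->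
  refs s' k.+1 r = refs s k r + (arrs s' 2 k == r) + (arrs s' 3 k == r).
Proof.
move=> same; rewrite /refs big_nat_recr //= addnA; congr (_ + _ + _).
by rewrite big_nat [RHS]big_nat; apply: eq_bigr => j /andP[_ /same[-> ->]].
Qed.

Lemma copies_leaf t : valid m b t -> leaf t ->
  forall i, copies t i = (head 0 (tsym t) == i) /\ touches t i = (head 0 (tsym t) == i).
Proof.
case: t => [c [|x [|//]] lo hi d] [//= _ _ _ _ _] /andP[_ /= le_hi] i.
rewrite /copies /touches /= inE eq_sym.
have -> : (lo <= i < hi) = false by lia.
by rewrite addn0 orbF.
Qed.

(** Task [k] ceases to be pending. A leaf child becomes a reference to an input, any other child a
    reference to the next gate together with a new pending task. The counting clauses then follow
    from the fields of [refines]. *)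
Lemma progress_step k v s q t1 t2 s' v' (q' := enqueue (enqueue q t1) t2) :
  progress k v s q -> k < size q -> refines m b (nth dummy q k) t1 t2 ->
  tbud t1 <= D ->
  memory s' q' -> regs s' rK = k.+1 ->
  arrs s' 2 k = child_ref q t1 -> arrs s' 3 k = child_ref (enqueue q t1) t2 ->
  (forall j, j != k -> arrs s' 2 j = arrs s 2 j /\ arrs s' 3 j = arrs s 3 j) ->
  v' + cost_of (nth dummy q k) = v + (if leaf t1 then 0 else cost_of t1) +
     (if leaf t2 then 0 else cost_of t2) ->
  progress k.+1 v' s' q'.
Proof.
move=> [M ek le_k er ok child gate input touch sz cst] lt_k rf le_D M' ek' e2 e3 same ev.
have v1 := refines_valid1 rf; have v2 := refines_valid2 rf.
have same' j : j < k -> arrs s' 2 j = arrs s 2 j /\ arrs s' 3 j = arrs s 3 j.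
  by move=> lt_j; apply: same; rewrite ltn_eqF.
have lt1 : k < size (enqueue q t1) by rewrite size_enqueue; lia.
have dk := drop_nth dummy lt_k.
have sum_q (f : task -> nat) : \sum_(t <- drop k q) f t =
   f (nth dummy q k) + \sum_(t <- drop k.+1 q) f t by rewrite dk big_cons.
have sum_q' (f : task -> nat) : \sum_(t <- drop k.+1 q') f t =
   \sum_(t <- drop k.+1 q) f t + (if leaf t1 then 0 else f t1) + (if leaf t2 then 0 else f t2).
  by rewrite /q' !sum_enqueue.
have l1 := leaf_head v1; have l2 := leaf_head v2.
split=> //.
- by rewrite /q' !size_enqueue; lia.
- by rewrite /q' !nth_enqueue //; lia.
- have ok1 : ~~ leaf t1 -> [/\ valid m b t1, ~~ leaf t1 & tbud t1 <= D] by [].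
  have ok2 : ~~ leaf t2 -> [/\ valid m b t2, ~~ leaf t2 & tbud t2 <= D].
    by move=> ?; split=> //; move: (refines_bud1 rf); rewrite (refines_bud2 rf) => -[->].
  move=> j; rewrite /q' /enqueue; case: ifP => lf2; case: ifP => lf1;
    rewrite ?nth_rcons ?size_rcons => lt_j.
  + exact: ok.
  + case: ltnP => [|ge_j]; first exact: ok.
    by rewrite ifT; [apply: ok1; rewrite lf1 | lia].
  + case: ltnP => [|ge_j]; first exact: ok.
    by rewrite ifT; [apply: ok2; rewrite lf2 | lia].
  + case: ltnP => [lt_j'|ge_j]; last by rewrite ifT; [apply: ok2; rewrite lf2 | lia].
    case: ltnP => [|ge_j]; first exact: ok.
    by rewrite ifT; [apply: ok1; rewrite lf1 | lia].
- move=> j; rewrite ltnS leq_eqVlt => /orP[/eqP->|lt_j].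
    exists t1, t2; rewrite e2 e3 /q' 2?nth_enqueue //; split=> //.
      by case: (linked_child t1 t2 lt_k).
    by case: (linked_child t2 t1 lt_k).
  have [u1 [u2 [rfu lu1 lu2]]] := child j lt_j.
  exists u1, u2; have [-> ->] := same' j lt_j.
  have ltq : j < size q by lia.
  have ltq1 : j < size (enqueue q t1) by rewrite size_enqueue; lia.
  rewrite /q' 2?nth_enqueue //.
  by split=> //; [apply: linked_mono (linked_mono lu1 _ _) _ _ |
                  apply: linked_mono (linked_mono lu2 _ _) _ _].
- move=> j; rewrite (refsS _ same') gate e2 e3 /child_ref !size_enqueue.
  case: ifP l1 => lf1 l1; case: ifP l2 => lf2 l2 /=.
  + have [h1 _] := l1 isT; have [h2 _] := l2 isT.
    by rewrite !ltn_eqF ?(leq_trans h1) ?(leq_trans h2) ?leq_addr //; lia.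
  + have [h1 _] := l1 isT.
    by rewrite [head _ _ == _]ltn_eqF ?(leq_trans h1) ?leq_addr // eqn_add2l; lia.
  + have [h2 _] := l2 isT.
    by rewrite [head _ _ == _]ltn_eqF ?(leq_trans h2) ?leq_addr // eqn_add2l; lia.
  + by rewrite !eqn_add2l; lia.
- move=> i lt_i; rewrite (refsS _ same') sum_q' e2 e3 /child_ref.
  have := input i lt_i; rewrite sum_q; have := refines_copies rf i.
  have c1 := copies_leaf v1; have c2 := copies_leaf v2.
  case: ifP c1 => lf1 c1; case: ifP c2 => lf2 c2.
  + by rewrite (c1 isT i).1 (c2 isT i).1; lia.
  + by rewrite (c1 isT i).1 [m + _ == i]gtn_eqF ?(leq_trans lt_i) ?leq_addr //; lia.
  + by rewrite (c2 isT i).1 [m + _ == i]gtn_eqF ?(leq_trans lt_i) ?leq_addr //; lia.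
  + by rewrite ![m + _ == i]gtn_eqF ?(leq_trans lt_i) ?leq_addr //; lia.
- move=> i lt_i; rewrite (refsS _ same') /q' !has_enqueue // e2 e3 /child_ref.
  have := touch i lt_i; rewrite dk /= => -[r0|]; first by left; lia.
  case/orP=> [/(refines_touches rf)|->]; last by right.
  have c1 := copies_leaf v1; have c2 := copies_leaf v2.
  case: ifP c1 => lf1 c1; case: ifP c2 => lf2 c2.
  + by rewrite (c1 isT i).2 (c2 isT i).2; left; lia.
  + by rewrite (c1 isT i).2 => /orP[->|->]; [left; lia | right; rewrite /= orbT].
  + by rewrite (c2 isT i).2 => /orP[->|->]; [right; rewrite /= ?orbT | left; lia].
  + by case/orP=> ->; right; rewrite /= !orbT.
- move: sz; rewrite sum_q sum_q'.
  have := refines_leaves rf; have := leaves_gt0 v1; have := leaves_gt0 v2.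
  have c1 := @leaf_leaves t1; have c2 := @leaf_leaves t2.
  case: ifP c1 => lf1 c1; case: ifP c2 => lf2 c2; last by lia.
  + by rewrite (c1 isT).1 (c2 isT).1; lia.
  + by rewrite (c1 isT).1; lia.
  + by rewrite (c2 isT).1; lia.
- move: cst ev; rewrite sum_q sum_q'.
  move: (cost_of _) (if _ then _ else _) (if _ then _ else _) => x y z; lia.
Qed.

Lemma mem_set_reg s q r n : r \notin [:: 0; 1; 2; rB; rHp] -> memory s q ->
  memory (set_reg s r n) q.
Proof.
move=> nr; apply: mem_frame => // r' hr' /=; case: eqP => // e.
by rewrite -e hr' in nr.
Qed.

Lemma mem_raise s q n : regs s rHp <= n -> memory s q -> memory (set_reg s rHp n) q.
Proof.
move=> le_n [em eB e2 ein epow ecnt st]; split=> // j lt_j.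
by case: (st j lt_j) => *; split=> //; apply: leq_trans le_n.
Qed.

Lemma mem_sorting s s' q : sorting s s' -> memory s q -> memory s' q.
Proof.
move=> [fr fa] [em eB e2 ein epow ecnt st].
split; rewrite ?fr //.
- by move=> i; rewrite fa.
- by move=> e le_e; rewrite fa //; apply: epow.
move=> j lt_j.
case: (st j lt_j) => *; split; rewrite ?fa ?fr // => i lt_i.
rewrite fa; last by rewrite (leq_trans _ (stored_hp (st j lt_j))) ?orbT // ltn_add2l.
by have := stored_slice (st j lt_j) lt_i.
Qed.

Lemma size_wsum w s : size s <= wsum w s.
Proof.
rewrite -sum1_size; apply: leq_sum => i _.
by rewrite expn_gt0.
Qed.

(** With budget 0 the total weight is at most 1, which leaves room for one input only, that is, for
    a leaf. *)
Lemma valid_bud w t : valid m w t -> ~~ leaf t -> 0 < tbud t.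
Proof.
case: t => c s lo hi [|//] [/= s0 _ _ _ [_ ft]]; apply: contraNT => _.
move: ft; rewrite /leaf /fits /=; case: ltnP => //= _ le1.
by have := size_wsum w s; rewrite expn0 in le1; lia.
Qed.

(** One gate is built, so the values [(leaves _).-1] of the factors add up to at least one less than
    before, which releases [200 * m]. Each of the [e] alternating elements lost releases
    [400 * (m * D.+1)]. *)
Lemma cost_step t t1 t2 e : refines m b t t1 t2 ->
  (thi t1 - tlo t1) + (thi t2 - tlo t2) + e <= thi t - tlo t ->
  (if leaf t1 then 0 else cost_of t1) + (if leaf t2 then 0 else cost_of t2) +
    200 * m + 400 * (m * D.+1) * e <= cost_of t.
Proof.
move=> rf le_n.
have bound u : (if leaf u then 0 else cost_of u) <= cost_of u by case: ifP.
apply: (@leq_trans (cost_of t1 + cost_of t2 + 200 * m + 400 * (m * D.+1) * e)).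
  by rewrite !leq_add2r leq_add.
have := leaves_gt0 (refines_valid1 rf); have := leaves_gt0 (refines_valid2 rf).
have := refines_leaves rf; rewrite /cost_of.
move: (200 * m) (400 * _) => x y le_l l2 l1.
have hx : x * (leaves t1).-1 + x * (leaves t2).-1 + x <= x * (leaves t).-1.
  by rewrite -mulnDr -[X in _ + X]muln1 -mulnDr leq_mul2l; apply/orP; right; clear -le_l l2 l1; lia.
have hy : y * (thi t1 - tlo t1) + y * (thi t2 - tlo t2) + y * e <= y * (thi t - tlo t).
  by rewrite -!mulnDr leq_mul2l le_n orbT.
by clear -hx hy; lia.
Qed.

(** The common end of both kinds of split; [p] is the code that replaces the fields of the first
    child by those of the second. *)
Lemma pushes_wp s q t1 t2 k (p : cmd) s0 v c0 :
  progress k v s0 q -> k < size q -> refines m b (nth dummy q k) t1 t2 ->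
  tbud t1 <= D -> tbud t1 = regs s rd -> regs s rK = k ->
  (forall j, j != k -> arrs s 2 j = arrs s0 2 j /\ arrs s 3 j = arrs s0 3 j) ->
  memory s q ->
  regs s nC = ~~ tand t1 -> regs s nSl = size (tsym t1) -> regs s nLo = tlo t1 ->
  regs s nHi = thi t1 -> slice s (regs s nSp) (tsym t1) ->
  regs s nSp + size (tsym t1) <= regs s rHp ->
  (forall s1, memory s1 (enqueue q t1) -> (forall r, r != 1 -> regs s1 r = regs s r) ->
     (forall i, arrs s1 aHeap i = arrs s aHeap i) ->
     wp p s1 (fun s2 c => [/\ [/\ memory s2 (enqueue q t1),
        forall x i, arrs s2 x i = arrs s1 x i, regs s2 rd = regs s rd & regs s2 rK = k],
        regs s2 nC = ~~ tand t2 /\ regs s2 nSl = size (tsym t2),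
        regs s2 nLo = tlo t2 /\ regs s2 nHi = thi t2,
        slice s2 (regs s2 nSp) (tsym t2) /\
        regs s2 nSp + size (tsym t2) <= regs s2 rHp & c <= c0])) ->
  wp (emit p) s (fun s' c =>
    exists2 q', progress k.+1 (v + (if leaf t1 then 0 else cost_of t1)
      + (if leaf t2 then 0 else cost_of t2) - cost_of (nth dummy q k)) s' q' &
      c <= c0 + 170).
Proof.
move=> pg lt_k rf le_D ed eK same M eC eSl eLo eHi sl hp step.
have v1 := refines_valid1 rf; have v2 := refines_valid2 rf.
have ed2 : tbud t2 = regs s rd.
  by rewrite -ed; move: (refines_bud1 rf); rewrite (refines_bud2 rf) => -[].
apply: wp_seq; apply: wp_conseq (push_wp (t := t1) _ M eC eSl eLo eHi _ sl hp _) _ => //.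
  by case: v1.
move=> s1 k1 [M1 fr1 e2 fa1 le1]; apply: wp_seq.
apply: wp_conseq (step s1 M1 fr1 _) _.
  by move=> i; apply: fa1.
move=> s2 k2 [[M2 fa2 ed2' eK2] [eC2 eSl2] [eLo2 eHi2] [sl2 hp2] le2]; apply: wp_seq.
apply: wp_conseq (push_wp (t := t2) _ M2 eC2 eSl2 eLo2 eHi2 _ sl2 hp2 _) _ => //.
- by rewrite ed2'.
- by case: v2.
move=> s3 k3 [M3 fr3 e3 fa3 le3]; apply: wp_assign.
exists (enqueue (enqueue q t1) t2); last by rewrite /=; lia.
rewrite eK in e2 fa1; rewrite eK2 in e3 fa3.
apply: (progress_step (s := s0) (v := v) pg lt_k rf) => //=.
- exact: mem_set_reg.
- by rewrite fr3 // eK2 addn1.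
- by rewrite fa3 // fa2.
- move=> j nj; rewrite !fa3 ?nj ?orbT // !fa2 !fa1 ?nj ?orbT //.
  exact: same.
have : cost_of (nth dummy q k) <= v.
  by apply: leq_trans (pg_cost pg); rewrite (drop_nth dummy lt_k) big_cons leq_addr.
by move: (cost_of _) (if _ then _ else _) (if _ then _ else _) => x y z; clear; lia.
Qed.

Hypothesis m_ge3 : 3 <= m.
Hypothesis small : forall i, i < m -> b i <= D.

(** The potential released by [cost_step] pays for one round; the summand 6 is the cost of the test
    of the main loop. *)
Lemma process_wp k v s q : progress k v s q -> k < size q ->
  wp process s (fun s' c => exists v' q', progress k.+1 v' s' q' /\ c + 6 + v' <= v).
Proof.
move=> pg lt_k; have M := pg_mem pg; have eK := pg_k pg.
have [vt nlf le_D] := pg_ok pg lt_k.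
have st := mem_task M lt_k.
have bud0 := valid_bud vt nlf.
have le_v : cost_of (nth dummy q k) <= v.
  by apply: leq_trans (pg_cost pg); rewrite (drop_nth dummy lt_k) big_cons leq_addr.
case et : (nth dummy q k) vt nlf le_D st bud0 => [c sy lo hi [//|d]] vt nlf /= le_D st _.
have [s0 us srt mem_sy [le_hi ft]] := vt; rewrite /= in s0 us srt mem_sy le_hi ft.
have size_sy : size sy <= m.
  rewrite -(size_iota 0 m); apply: uniq_leq_size => // i /mem_sy[lt_i _].
  by rewrite mem_iota.
case: st => /= eC eSl eLo eHi eBud sl hp.
rewrite /process /load; run; rewrite eK eC eSl eLo eHi eBud subn1 /=.
set s1 := set_reg _ _ _.
have M1 : memory s1 q by rewrite /s1; do 6!(apply: mem_set_reg; first by []).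
apply: wp_conseq
  (scan_prefix_wp (sy := sy) (lo := lo) (hi := hi) (d := d) M1 _ _ _ _ _ _ _) _ => //.
- exact: ltnW.
- by move=> i /mem_sy[/small].
move=> s2 c2 [j [-> le_j le_w max_j le_c2]].
set s3 := set_reg _ _ _.
have M3 : memory s3 q by rewrite /s3; do 2!(apply: mem_set_reg; first by []).
apply: wp_if; rewrite [eval _ _]/= addn1.
  rewrite addn_eq0 !eqb0 -negb_or negbK => cond.
  have rf : refines m b (nth dummy q k) (Task c (take j sy) 0 0 d) (Task c (drop j sy) lo hi d).
    by rewrite et; apply: prefix_refines.
  have := cost_step (e := 0) rf; rewrite {1 2}et /= muln0 !addn0 => /(_ (leqnn _)).
  set A1 := if leaf (Task c (take j sy) 0 0 d) then _ else _.
  set A2 := if leaf (Task c (drop j sy) lo hi d) then _ else _.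
  move=> le_c; rewrite /split_prefix; run.
  have le_js : j <= size sy by rewrite (leq_trans le_j) ?leq_subr.
  have size_t : size (take j sy) = j by rewrite size_takel.
  set s4 := set_reg _ _ _.
  apply: wp_conseq (pushes_wp (s := s4) (c0 := 40) pg lt_k rf _ _ _ _ _ _ _ _ _ _ _ _) _ => //=.
  + exact: ltnW.
  + by rewrite /s4; do 5!(apply: mem_set_reg; first by []).
  + by move=> i; rewrite size_t => lt_i; rewrite nth_take // -sl //; apply: leq_trans le_js.
  + by rewrite size_t (leq_trans _ hp) // leq_add2l.
  + move=> s5 M5 fr5 fa5; run; split=> //=.
    * split.
      - by do 4!(apply: mem_set_reg; first by []).
      - by [].
      - by rewrite /= fr5.
      - by rewrite /= fr5 //= eK.
    * by rewrite !fr5 //= size_drop.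
    * by rewrite !fr5.
    split; last by rewrite !fr5 //= size_drop -addnA subnKC.
    move=> i; rewrite size_drop => lt_i /=.
    by rewrite fa5 !fr5 //= -addnA nth_drop -sl //; lia.
  move=> s5 c5 [q' pg' le_c5]; eexists _, q'; split; first exact: pg'.
  move: le_c5 le_c le_v le_c2 size_sy m_ge3; rewrite /= -/A1 -/A2 et.
  by move: (cost_of _) A1 A2 => x y z; clear; lia.
move=> /eqP; rewrite addn_eq0 !eqb0 -ltnNge -leqNgt => /andP[lt_lo ge_j].
(* The prefix scan went through all of [sy], which therefore weighs at most 2^d: this is the case of
   the alternating split. *)
have ej : take j sy = sy by apply: take_oversize.
have {le_w} le_w : wsum b sy <= 2 ^ d by rewrite -[X in wsum _ X]ej.
have lt_lo_m : lo < m by apply: leq_trans le_hi.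
apply: wp_seq.
apply: wp_conseq
  (scan_cut_wp (sy := sy) (lo := lo) (hi := hi) (d := d) M3 _ _ _ _ _ _ _ _ _ _) _ => //=.
- exact: ltnW.
- by rewrite ej.
- by rewrite lt_lo.
move=> s4 c4 [cut [-> [ev /andP[le_cut lt_cut]] fc max_cut le_c4]].
set s5 := set_reg _ _ _.
have M5 : memory s5 q by rewrite /s5; do 4!(apply: mem_set_reg; first by []).
have lt_cut_m : cut < m by apply: leq_trans le_hi.
apply: wp_seq; apply: wp_conseq (sort_evens_wp (lo := lo) (cut := cut) (d := d) M5 _ _ _ _) _ => //.
  by rewrite le_cut.
(* Alternating weights are at most 2^d by [fits_alt_wsum], so the [d.+1] buckets miss no input. *)
have pL : perm_eq (bsort b d.+1 (evens lo cut)) (evens lo cut).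
  rewrite (perm_trans (bsort_perm _ _ _)) // (eq_in_filter (a2 := predT)) ?filter_predT //.
  move=> i /mem_evens /andP[lo_i i_cut]; rewrite /= ltnS -(leq_exp2l _ _ (isT : 1 < 2)).
  apply: leq_trans (fits_alt_wsum lt_lo s0 ft).
  by rewrite (bigD1_seq i) ?iota_uniq ?mem_index_iota //= ?leq_addr //; lia.
have srtL : sorted (heavier b) (bsort b d.+1 (evens lo cut)) by apply: bsort_sorted.
move: (bsort _ _ _) pL srtL => L pL srtL.
move=> s6 c6 [so [slL eQ] le_c6]; have M6 := mem_sorting so M5.
have [fr6 fa6] := so.
have rf : refines m b (nth dummy q k) (Task c sy lo cut d) (Task (~~ c) L cut.+1 hi d).
  by rewrite et; apply: cut_refines => //; rewrite le_cut.
have := cost_step (e := 1) rf; rewrite {1 2}et /= muln1.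
have le_n : cut - lo + (hi - cut.+1) + 1 <= hi - lo by clear -le_cut lt_cut; lia.
move=> /(_ le_n).
set A1 := if leaf (Task c sy lo cut d) then _ else _.
set A2 := if leaf (Task (~~ c) L cut.+1 hi d) then _ else _.
move=> le_c; rewrite /split_cut; run; rewrite !fr6 //=.
set s7 := set_reg _ _ _.
have eHp : regs s5 rHp = regs s rHp by [].
apply: wp_conseq (pushes_wp (s := s7) (c0 := 60) pg lt_k rf _ _ _ _ _ _ _ _ _ _ _ _) _ => //=.
+ exact: ltnW.
+ by rewrite fr6.
+ by rewrite fr6.
+ by move=> i ni; rewrite !fa6.
+ by rewrite /s7; do 5!(apply: mem_set_reg; first by []).
+ by move=> i lt_i /=; rewrite fa6 /= ?sl // (leq_trans _ hp) ?orbT // ltn_add2l.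
+ by rewrite fr6.
+ move=> s8 M8 fr8 fa8; run; split=> //=.
  * split.
    - apply: mem_raise; last by do 5!(apply: mem_set_reg; first by []).
      by rewrite /= !fr8 //= fr6 //= eQ leq_addr.
    - by [].
    - by rewrite /= fr8.
    - by rewrite /= fr8 //= fr6 //= eK.
  * rewrite !fr8 //= eQ eHp ?(fr6 rHp) //= addKn; split=> //.
    by rewrite (fr6 rC) //=; case: (c).
  * by rewrite !fr8 //= ?(fr6 rCut) ?(fr6 rHi) //= addn1.
  split; last by rewrite !fr8 //= eQ eHp ?(fr6 rHp) //= leqnn.
  by move=> i lt_i; rewrite /= !fr8 //= ?(fr6 rHp) //= fa8 /=; apply: slL.
move=> s8 c8 [q' pg' le_c8]; eexists _, q'; split; first exact: pg'.
have le_dD : m * d <= m * D by rewrite leq_mul2l (ltnW le_D) orbT.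
have le_d3 : 3 * d <= m * d by rewrite leq_mul2r m_ge3 orbT.
move: le_c8 le_c le_v le_c2 le_c4 le_c6 size_sy m_ge3 le_D le_dD le_d3; rewrite /= -/A1 -/A2 et.
by move: (cost_of _) A1 A2 => x y z; clear; lia.
Qed.

End MainLoop.

(** * Correctness of the program and integer bounds on B and D *)

Section Correctness.

Variables (m : nat) (a : nat -> nat).
Hypothesis m_ge3 : 3 <= m.

Lemma root_valid B K D : scaling m a B K D -> valid m (fun i => a i - B) (root_task m D).
Proof.
move=> sc; have m1 : 1 < m by lia.
split=> //=; first by move=> i; rewrite inE => /eqP->; split=> //; lia.
split=> //; rewrite /fits m1.
have D0 : 0 < D by have := scale_K3 m_ge3 (scale_K sc); have := scale_KD sc; lia.
rewrite D0 /= /wsum big_seq1; apply: leq_trans (scale_root sc).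
by rewrite /root_load /weight_mid; lia.
Qed.

Lemma copies_root D i : 3 <= D -> copies (root_task m D) i <= D.-1.
Proof.
rewrite /copies /= inE; case: eqP => [->|_] /=; first by lia.
by case: (_ && _); lia.
Qed.

Lemma leaves_root D : 3 <= D -> (leaves (root_task m D)).-1 <= m * D.-1.
Proof.
by move=> D3; rewrite /leaves /= (maxn_idPr _) ?leq_mul2r; lia.
Qed.

Lemma program_wp s : (forall r, regs s r = if r == 0 then m else 0) ->
  (forall x i, arrs s x i = if x == 0 then a i else 0) ->
  wp program s (fun s' k => exists B K D v q,
    [/\ scaling m a B K D, progress m a B D (size q) v s' q & k <= 1500 * (m * (m * D))]).
Proof.
move=> es ea; apply: wp_seq; apply: wp_conseq (setup_wp m_ge3 es ea) _.
move=> s1 k1 [B [K [D [sc M eK le_k1]]]].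
have K3 := scale_K3 m_ge3 (scale_K sc).
have D3 : 3 <= D := leq_trans K3 (scale_KD sc).
have small i : i < m -> a i - B <= D.
  by move=> lt_i; apply: leq_trans (scale_max sc lt_i) (scale_KD sc).
have pg0 : progress m a B D 0 (cost_of m D (root_task m D)) s1 [:: root_task m D].
  split=> //.
  - case=> // _ /=; split=> //; first exact: root_valid sc.
    by rewrite /leaf /= -ltnNge; lia.
  - by move=> j; rewrite /refs big_geq //=; case: j => [|[]].
  - by move=> i lt_i; rewrite /refs big_geq // drop0 big_seq1.
  - move=> i lt_i; right; rewrite /= orbF /touches /= inE; lia.
  - by rewrite drop0 big_seq1.
  - by rewrite drop0 big_seq1.
apply: wp_conseq (wp_while (v := cost_of m D (root_task m D)) (I := fun v s' =>
  exists k q, progress m a B D k v s' q) _ _) _.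
- move=> v s2 [k [q pg]]; rewrite /= (pg_k pg) (mem_cnt (pg_mem pg)) addn1 eqb0 negbK => lt_k.
  apply: wp_conseq (process_wp m_ge3 small pg lt_k) _ => s3 c [v' [q' [pg' le_c]]].
  by exists v'; split; first by exists k.+1, q'.
- by exists 0, [:: root_task m D].
move=> s2 k2 [v [[k [q pg]]]].
rewrite /= (pg_k pg) (mem_cnt (pg_mem pg)) addn1 => /eqP; rewrite eqb0 -ltnNge ltnS => ge_k le_k2.
have ek : k = size q by have := pg_le pg; lia.
rewrite ek in pg; exists B, K, D, v, q; split=> //.
have le1 : (leaves (root_task m D)).-1 <= m * D.
  by rewrite (leq_trans (leaves_root D3)) // leq_mul2l; lia.
have c1 : 200 * m * (leaves (root_task m D)).-1 <= 200 * (m * (m * D)).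
  by rewrite -mulnA !leq_mul2l le1 !orbT.
have c2 : 400 * (m * D.+1) * (m - 1) <= 800 * (m * (m * D)).
  have h : D.+1 * (m - 1) <= 2 * (m * D) by move: m_ge3 D3; clear; nia.
  rewrite (_ : 800 * _ = 400 * m * (2 * (m * D))); last by clear; lia.
  by rewrite mulnA -[_ * D.+1 * _]mulnA leq_mul2l h orbT.
have c3 : m * D <= m * (m * D) by rewrite leq_pmull //; lia.
have c4 : 9 <= m * (m * D) by move: m_ge3 D3; clear; nia.
move: le_k1 le_k2 c1 c2 c3 c4; rewrite /cost_of /=.
by move: (m * (m * D)) (m * D) (200 * m * _) (400 * _ * _) => x y z t; clear; lia.
Qed.

(** Let w be the scaled total weight. Minimality of D, or that of K if D = K, gives 2^y <= y w, and
    w < 2m by the choice of B. The last bound combines this with w 2^B <= 3W, W being the unscaled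
    total. *)
Lemma scaling_bounds B K D (y := D.-1) : scaling m a B K D ->
  [/\ 3 <= D, 2 ^ y < 2 * m * y, m = 3 -> y <= 3 &
      2 ^ (B + y) <= 3 * y * (\sum_(0 <= i < m) 2 ^ a i)].
Proof.
move=> sc; have K3 := scale_K3 m_ge3 (scale_K sc).
have D3 : 3 <= D := leq_trans K3 (scale_KD sc).
have y2 : 2 <= y by rewrite /y; lia.
have small := scale_small sc.
have le_y : 2 ^ y <= y * wtotal m a B.
  case: (scale_Dmin sc) => [eD|]; last first.
    by rewrite -/y => lt_y; have := @root_load_le m a m_ge3 B y y2; move: lt_y; clear; lia.
  have := scale_Kmin sc; rewrite -eD -/y; have := wtotal_ge m a B.
  by move: (2 ^ y) (wtotal _ _ _) y2 => u w; clear; nia.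
split=> //.
- by apply: leq_ltn_trans le_y _; rewrite mulnC ltn_pmul2r //; lia.
(* For m = 3 the inequality 2^y < 2my would allow y = 4, too much for the later logarithmic
   estimate, so the root condition is inspected directly. *)
- move=> m3; rewrite leqNgt; apply/negP => y4.
  case: (scale_Dmin sc) => [eD|lt_y].
    have := scale_Kmin sc; rewrite -eD -/y m3.
    by have := leq_pexp2l (isT : 0 < 2) y4; rewrite -[2 ^ 4]/16; lia.
  have := sqr_le_exp y4; rewrite -mulnn; move: lt_y small; rewrite -/y /root_load wtotalE //.
  rewrite /weight_mid m3 /= big_nat1.
  by move: (2 ^ y) (2 ^ _) (2 ^ _) (2 ^ _) y4 => u v w z; clear; nia.
(* Raising arrival times to B adds at most m 2^B to W. For B > 0, minimality gives 2m 2^(B-1) <= W +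
   m 2^(B-1), hence m 2^B <= 2W. *)
have le_B : wtotal m a B * 2 ^ B <= 3 * (\sum_(0 <= i < m) 2 ^ a i).
  have le_w B' : wtotal m a B' * 2 ^ B' <= \sum_(0 <= i < m) 2 ^ a i + m * 2 ^ B'.
    rewrite /wtotal big_distrl /= (_ : m * 2 ^ B' = \sum_(0 <= i < m) 2 ^ B'); last first.
      by rewrite sum_nat_const_nat subn0 mulnC.
    rewrite -big_split /=; apply: leq_sum => i _.
    rewrite -expnD; case: (leqP B' (a i)) => le_a; first by rewrite subnK // leq_addr.
    by rewrite (_ : a i - B' = 0) ?leq_addl //; lia.
  case: (scale_Bmin sc) => [->|big].
    rewrite muln1 /wtotal (eq_bigr (fun i => 2 ^ a i)) => [|i _]; last by rewrite subn0.
    by rewrite leq_pmull.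
  case: (posnP B) => [->|B0].
    rewrite muln1 /wtotal (eq_bigr (fun i => 2 ^ a i)) => [|i _]; last by rewrite subn0.
    by rewrite leq_pmull.
  have eB : 2 ^ B = 2 * 2 ^ B.-1 by rewrite -expnS prednK.
  have := le_w B.-1; have := le_w B; rewrite eB.
  have := leq_mul big (leqnn (2 ^ B.-1)).
  move: (\sum_(_ <= _ < _) _) (2 ^ _) (wtotal _ _ _) (wtotal _ _ _) => W p u v.
  by clear; lia.
rewrite expnD mulnC; apply: leq_trans (leq_mul le_y (leqnn _)) _.
by rewrite -mulnA [3 * y]mulnC -mulnA leq_mul2l le_B orbT.
Qed.

End Correctness.

Lemma circuit_of_program m (a : 'I_m -> nat) : 3 <= m -> exists s k B y,
  [/\ exec program (input_state a) s k,
      [/\ k <= 1500 * (m * (m * y.+1)), 2 ^ y < 2 * m * y, m = 3 -> y <= 3 &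
          2 ^ (B + y) <= 3 * y * (\sum_(i < m) 2 ^ a i)] &
      let c := output_netlist m s in
      [/\ is_circuit c, realizes c (fun t => and_or_path t),
          delay c a <= B + y.+1, size_of c <= m * y & max_fanout c <= y]].
Proof.
move=> m3; pose a' i := oapp a 0 (insub i).
have [||s [k [ex [B [K [D [v [q [sc pg le_k]]]]]]]]] := @program_wp m a' m3 (input_state a) => //.
have [D3 b1 b2 b3] := scaling_bounds m3 sc.
have ea' (i : 'I_m) : a' i = a i by rewrite /a' insubT //= => lt_i; congr (a _); apply: val_inj.
have eW : \sum_(0 <= i < m) 2 ^ a' i = \sum_(i < m) 2 ^ a i.
  by rewrite big_mkord; apply: eq_bigr => i _; rewrite ea'.
have M := pg_mem pg; have eg := mem_cnt M.
exists s, k, B, D.-1; split=> //; first by rewrite prednK ?(leq_trans _ D3) // -eW.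
have q0 : 0 < size q by have := pg_root pg; case: (q) => //; rewrite nth_nil => -[].
have m0 : 0 < m by lia.
have root_ref := mem_root M.
have kindP j : j < regs s 1 -> (arrs s 1 j == 0) = tand (nth dummy q j).
  by rewrite eg => /(mem_task M)[-> _ _ _ _ _ _]; case: tand.
have childP j : j < regs s 1 -> exists t1 t2,
  [/\ refines m (fun i => a' i - B) (nth dummy q j) t1 t2,
      linked m (nth dummy q) (regs s 1) j (arrs s 2 j) t1 &
      linked m (nth dummy q) (regs s 1) j (arrs s 3 j) t2].
  by rewrite eg => /(pg_child pg).
have gate_refs j : j < regs s 1 -> refs s (regs s 1) (m + j) = (0 < j).
  by rewrite eg (pg_gate pg) => ->; rewrite andbT.
have input_refs i : i < m -> 0 < refs s (regs s 1) i <= D.-1.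
  rewrite eg => lt_i; have := pg_touch pg lt_i; have := pg_input pg lt_i.
  rewrite drop_size big_nil addn0 => le_i [-> /=|//].
  exact: leq_trans le_i (copies_root _ _ D3).
have g0 : 0 < regs s 1 by rewrite eg.
have F0 : 0 < D.-1 by lia.
have bud0 : tbud (nth dummy q 0) = D by rewrite (pg_root pg).
split.
- exact: (is_circuitP g0 root_ref kindP childP gate_refs input_refs F0 bud0).
- apply: (realizesP g0 root_ref kindP childP) => t.
  by rewrite (pg_root pg) tval_root.
- rewrite prednK ?(leq_trans _ D3) //.
  by apply: (delay_le g0 root_ref kindP childP gate_refs input_refs F0 bud0) => i; rewrite ea'.
- rewrite (size_ofE _ kindP) eg; have := pg_size pg.
  by rewrite drop_size big_nil addn0 => le_q; apply: leq_trans le_q (leaves_root _ D3).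
exact: (max_fanout_le g0 root_ref kindP childP gate_refs input_refs F0 bud0).
Qed.

(** * Binary logarithms *)

Import Order.TTheory GRing.Theory Num.Theory.
Local Open Scope ring_scope.

Section Log2.

Variable R : realType.
Implicit Types x y : R.

Lemma ln2_gt0 : 0 < ln 2 :> R.
Proof. by rewrite ln_gt0 // ltr1n. Qed.

Lemma log2M x y : 0 < x -> 0 < y -> log2 (x * y) = log2 x + log2 y.
Proof. by move=> x0 y0; rewrite /log2 lnM ?posrE // mulrDl. Qed.

Lemma log2X n x : 0 < x -> log2 (x ^+ n) = n%:R * log2 x.
Proof. by move=> x0; rewrite /log2 lnXn // -[ln x *+ n]mulr_natl mulrA. Qed.

Lemma log2_2 : log2 2 = 1 :> R.
Proof. by rewrite /log2 divff // gt_eqF // ln2_gt0. Qed.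

Lemma log2_2X n : log2 (2 ^+ n) = n%:R :> R.
Proof. by rewrite log2X ?ltr0n // log2_2 mulr1. Qed.

Lemma ler_log2 x y : 0 < x -> x <= y -> log2 x <= log2 y.
Proof.
move=> x0 xy; rewrite /log2 ler_pM2r ?invr_gt0 ?ln2_gt0 // ler_ln ?posrE //.
exact: lt_le_trans xy.
Qed.

Lemma log2_ge x p q : 0 < x -> 2 ^+ p <= x ^+ q -> p%:R <= q%:R * log2 x.
Proof.
move=> x0 le_x; rewrite -log2X // -log2_2X; apply: ler_log2 => //.
by rewrite exprn_gt0 // ltr0n.
Qed.

Lemma log2_le x p q : 0 < x -> x ^+ q <= 2 ^+ p -> q%:R * log2 x <= p%:R.
Proof.
by move=> x0 le_x; rewrite -log2X // -log2_2X; apply: ler_log2 => //; rewrite exprn_gt0.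
Qed.

Lemma log2_3_le : log2 3 <= 8 / 5 :> R.
Proof.
have /log2_le le3 : (3 : R) ^+ 5 <= 2 ^+ 8 by rewrite -!natrX ler_nat.
by have := le3 (ltr0n _ _); lra.
Qed.

Lemma log2_nat_ge m p q : (0 < m)%N -> (2 ^ p <= m ^ q)%N ->
  p%:R <= q%:R * log2 (m%:R : R).
Proof.
by move=> m0 le_m; apply: log2_ge; rewrite ?ltr0n // -!natrX ler_nat.
Qed.

Lemma log2_small m : (3 <= m)%N ->
  let L := log2 (m%:R : R) in 3 / 2 <= L /\ 0 < log2 L.
Proof.
move=> m3 /=; have m0 : (0 < m)%N by apply: leq_trans m3.
have L1 : 3 / 2 <= log2 (m%:R : R).
  have le8 : (2 ^ 3 <= m ^ 2)%N by apply: (@leq_trans (3 ^ 2)%N); rewrite // leq_sqr.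
  by have := log2_nat_ge m0 le8; lra.
split=> //; rewrite /log2 divr_gt0 ?ln2_gt0 // ln_gt0 //.
by rewrite -/(log2 _); lra.
Qed.

Lemma exp2_ge n : (8 <= n)%N -> (32 * n <= 2 ^ n)%N && (4 * (n * n) <= 2 ^ n)%N.
Proof.
elim: n => // n IH; rewrite leq_eqVlt => /orP[/eqP<- //|]; rewrite ltnS => le_n.
have /andP[h1 h2] := IH le_n; rewrite expnS; move: h1 h2; move: (2 ^ n)%N => x h1 h2.
by apply/andP; split; nia.
Qed.

(** The bound on m comes from 32n <= 2^n. The other one comes from 4n^2 <= 2^n, since (2^n)^2 < 4
    m^2 n^2 <= m^2 2^n. *)
Lemma log2_sqr_le m n : (8 <= n)%N -> (2 ^ n < 2 * m * n)%N -> (16 <= m)%N && (2 ^ n <= m ^ 2)%N.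
Proof.
move=> n8 lt_m; have /andP[h1 h2] := exp2_ge n8; apply/andP; split.
  by move: lt_m h1; move: (2 ^ n)%N => x; nia.
by rewrite -mulnn; move: lt_m h1 h2; move: (2 ^ n)%N => x; nia.
Qed.

(** For y >= 8 crude estimates suffice. For y <= 7, rational lower bounds on L and log2 L are
    needed, separately for m >= 5, m = 3 and m = 4. *)
Lemma loglog_ge (m y : nat) : (3 <= m)%N -> (2 ^ y < 2 * m * y)%N -> (m = 3%N -> y <= 3)%N ->
  let L := log2 (m%:R : R) in y%:R <= 3 * (L * log2 L) /\ y.+1%:R <= 6 * L.
Proof.
move=> m3 lt_y y3 /=; have m0 : (0 < m)%N by apply: leq_trans m3.
have [L1 LL0] := log2_small m3.
set L := log2 (m%:R : R) in L1 LL0 *; have L0 : 0 < L by lra.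
have y1 : y.+1%:R = y%:R + 1 :> R by rewrite -natr1.
have [y8|y7] := leqP 8 y.
  have /andP[m16 le_m] := log2_sqr_le y8 lt_y.
  have Ly : y%:R <= 2 * L by apply: log2_nat_ge.
  have L4 : 4 <= L.
    by have := @log2_nat_ge m 4 1 m0; rewrite expn1 -/L mul1r; apply.
  have LL2 : 2 <= log2 L.
    have := @log2_ge L 2 1 L0; rewrite expr1 mul1r; apply.
    by rewrite expr2; lra.
  by rewrite y1; split; nra.
have y7R : y%:R <= 7 :> R by rewrite ler_nat -ltnS.
have [m5|m4] := leqP 5 m.
  (* The bounds 9/4 and 11/10 give 3 L log2 L >= 7.425, enough for y <= 7. *)
  have L94 : 9 / 4 <= L.
    have le9 : (2 ^ 9 <= m ^ 4)%N by apply: (@leq_trans (5 ^ 4)%N); rewrite // leq_exp2r.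
    by have := log2_nat_ge m0 le9; rewrite -/L; lra.
  have LL : 11 / 10 <= log2 L.
    have L2 : 5 <= L ^+ 2 by rewrite expr2; nra.
    have L10 : 2 ^+ 11 <= L ^+ 10.
      have L5 : 5 ^+ 5 <= L ^+ 10.
        have -> : L ^+ 10 = (L ^+ 2) ^+ 5 by rewrite -exprM.
        by apply: lerXn2r => //; rewrite nnegrE; lra.
      apply: le_trans L5.
      by rewrite -!natrX ler_nat.
    by have := log2_ge L0 L10; lra.
  by rewrite y1; split; nra.
have [m_eq3|m_eq4] : m = 3%N \/ m = 4%N by lia.
  have y3R : y%:R <= 3 :> R by rewrite ler_nat y3.
  (* From 2^11 <= 3^7. The bounds 11/7 and 7/11 have product 1, so that 3 L log2 L >= 3, exactly
     what y <= 3 requires. *)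
  have L11 : 11 / 7 <= L.
    by have := @log2_nat_ge m 11 7 m0; rewrite -/L m_eq3 => /(_ isT); lra.
  have LL : 7 / 11 <= log2 L.
    have L2 : 49 / 20 <= L ^+ 2 by rewrite expr2; nra.
    have L4 : 6 <= L ^+ 4 by rewrite (exprM L 2 2) [_ ^+ 2 ^+ 2]expr2; nra.
    have L8 : 36 <= L ^+ 8 by rewrite (exprM L 4 2) [_ ^+ 4 ^+ 2]expr2; nra.
    have L11' : 2 ^+ 7 <= L ^+ 11.
      have L3 : 11 / 7 * (49 / 20) <= L ^+ 3 by rewrite exprS; apply: ler_pM => //; lra.
      have L83 : 36 * (11 / 7 * (49 / 20)) <= L ^+ 8 * L ^+ 3 by apply: ler_pM => //; lra.
      by rewrite (exprD L 8 3); apply: le_trans L83; rewrite -natrX; lra.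
    by have := log2_ge L0 L11'; lra.
  by rewrite y1; split; nra.
(* For m = 4 the hypothesis reads 2^y < 8y, which fails for y = 6 and y = 7. *)
have y5 : (y <= 5)%N.
  by rewrite leqNgt; apply/negP => y6; move: lt_y; rewrite m_eq4;
    case: y y6 y7 {y3 y1 y7R} => [|[|[|[|[|[|[|[|//]]]]]]]].
have y5R : y%:R <= 5 :> R by rewrite ler_nat.
have eL : L = 2.
  by rewrite /L m_eq4 (_ : 4 = 2 ^+ 2) ?log2_2X // -natrX.
by rewrite y1 eL log2_2; lra.
Qed.

End Log2.

Theorem theorem4p4 (R : realType) :
  exists (P : cmd) (C : nat),
    forall (m : nat) (a : 'I_m -> nat), (3 <= m)%N ->
    let M : R := m%:R in
    let W : nat := (\sum_(i < m) 2 ^ a i)%N in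
    exists (s : state) (k : nat),
      exec P (input_state a) s k /\
      k%:R <= C%:R * (M ^+ 2 * log2 M) /\
      let c := output_netlist m s in
      [/\ is_circuit c,
          realizes c (fun t => and_or_path t),
          (delay c a)%:R
            <= log2 W%:R + log2 (log2 M) + log2 (log2 (log2 M)) + 43 / 10,
          (size_of c)%:R <= 10 * M * log2 M * log2 (log2 M) &
          (max_fanout c)%:R
            <= log2 M + log2 (log2 M) + log2 (log2 (log2 M)) + 33 / 10].
Proof.
(* The factor 6 comes from y + 1 <= 6 log2 m, applied to the step count 1500 m^2 (y + 1). *)
exists program, (1500 * 6)%N => m a m3 M W.
have [s [k [B [y [ex [le_k lt_y y3 le_W] [circ real le_d le_s le_f]]]]]] := circuit_of_program a m3.
exists s, k; split=> //.
have [le_y le_y6] := loglog_ge R m3 lt_y y3; have [L1 LL0] := log2_small R m3.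
rewrite -/M in le_y le_y6 L1 LL0; set L := log2 M in le_y le_y6 L1 LL0 *.
have L0 : 0 < L by lra.
have M0 : 0 < M by rewrite ltr0n; apply: leq_trans m3.
have W0 : 0 < W%:R :> R.
  rewrite ltr0n /W (bigD1 (Ordinal (leq_trans (isT : 0 < 3)%N m3))) //=.
  by rewrite addn_gt0 expn_gt0.
have x0 : 0 < L * log2 L by apply: mulr_gt0.
have log23 := log2_3_le R.
have log6 : log2 6 = 1 + log2 3 :> R.
  by rewrite (_ : 6 = 2 * 3) -?natrM // natrM log2M ?ltr0n // log2_2.
have log18 : log2 18 = 1 + 2 * log2 3 :> R.
  rewrite (_ : 18 = 2 * 3 ^+ 2); last by rewrite -natrX -natrM.
  by rewrite log2M ?exprn_gt0 ?ltr0n // log2_2 log2X ?ltr0n.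
split.
  have -> : (1500 * 6)%:R * (M ^+ 2 * L) = 1500%:R * (M * (M * (6 * L))).
    by rewrite natrM expr2; ring.
  apply: (@le_trans _ _ (1500 * (m * (m * y.+1)))%:R); first by rewrite ler_nat.
  by rewrite !natrM ler_pM2l ?ltr0n // !ler_pM2l.
move=> c; split=> //.
- apply: (@le_trans _ _ (B + y.+1)%:R); first by rewrite ler_nat.
  (* 2^(B+y+1) <= 6 y W <= 18 W L log2 L, and log2 18 <= 4.2. *)
  rewrite -(log2_2X R (B + y.+1)); apply: (@le_trans _ _ (log2 (18 * (W%:R * (L * log2 L))))).
    apply: ler_log2; first by rewrite exprn_gt0 ?ltr0n.
    rewrite addnS exprS -natrX.
    have : (2 ^ (B + y))%:R <= 3 * y%:R * W%:R :> R by rewrite -!natrM ler_nat.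
    have : y%:R * W%:R <= 3 * (L * log2 L) * W%:R by rewrite ler_pM2r.
    move: (2 ^ _)%:R (L * log2 L) => u x h1 h2; nra.
  rewrite log2M ?(log2M W0 x0) ?(log2M L0 LL0) ?ltr0n //; last exact: mulr_gt0.
  by rewrite log18; lra.
- apply: (@le_trans _ _ (m * y)%:R); first by rewrite ler_nat.
  have -> : 10 * M * L * log2 L = M * (10 * (L * log2 L)) by ring.
  by rewrite natrM ler_pM2l //; lra.
- apply: (@le_trans _ _ y%:R); first by rewrite ler_nat.
  (* 2^y < 2 m y <= 6 m L log2 L, and log2 6 <= 2.6. *)
  rewrite -(log2_2X R y); apply: (@le_trans _ _ (log2 (6 * (M * (L * log2 L))))).
    apply: ler_log2; first by rewrite exprn_gt0 ?ltr0n.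
    have : (2 ^ y)%:R <= 2 * M * y%:R :> R by rewrite -!natrM ler_nat ltnW.
    rewrite natrX => le2; apply: le_trans le2 _.
    by have := ler_pM2l M0 y%:R (3 * (L * log2 L)); rewrite le_y => h; lra.
  rewrite log2M ?(log2M M0 x0) ?(log2M L0 LL0) ?ltr0n //; last exact: mulr_gt0.
  by rewrite log6 -/L; lra.
Qed.
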